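(* Let $\mathcal I$ be the open and dense set of step skew products with fiber a segment described in the context (every element of which satisfies properties (1)–(4) listed there). Then for any $F\in\mathcal I$, with strictly trapping strips $\Pi_1,\dots,\Pi_l$ and attracting graphs $\Gamma_i\subset\Pi_i$ as in the context, the Milnor attractor of $F$ is the closure of the union of the graphs $\Gamma_i$: $$A_M(F)=\overline{\bigcup_{i=1}^{l}\Gamma_i}.$$
   Context: Base. $(\Sigma,\sigma)$ is a transitive topological Markov chain with finitely many states: $\Sigma$ is the set of biinfinite sequences $\omega=(\omega_n)_{n\in\mathbb Z}$ over a finite alphabet all of whose transitions $\omega_n\to\omega_{n+1}$ are admissible for a fixed $0$-$1$ transition matrix such that any state can be reached from any state by an admissible path; $(\sigma\omega)_n=\omega_{n+1}$; the distance is $d(\omega,\tilde\omega)=2^{-m}$, $m=\min\{|n|:\omega_n\ne\tilde\omega_n\}$. An ergodic $\sigma$-invariant Markov probability measure $\mu_\Sigma$ for which all admissible transitions have positive probability is fixed. (The Bernoulli shift with a Bernoulli measure is a special case.) Step skew products. $I$ is a segment, $X=\Sigma\times I$, $F:X\to X$, $F(\omega,x)=(\sigma\omega,f_{\omega_0}(x))$, where the fiber maps $f_j:I\to I$ (one for each symbol $j$) are orientation preserving $C^r$-diffeomorphisms, $r\ge1$, onto their images. The space of such maps is endowed with the $C^r$-topology on the tuples of fiber maps. $\mu_X=\mu_\Sigma\times\mathrm{Leb}$, and the metric on $X$ is the sum of the distances in the base and in the fiber. Milnor attractor. $A_M(F)$ is the smallest closed subset of $X$ that contains the $\omega$-limit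 sets $\omega(x)$ of $\mu_X$-almost all points $x\in X$. Strips and bony graphs. A strip is a subset $\Pi=\{(\omega,x):\psi_1(\omega)\le x\le\psi_2(\omega)\}$ bounded by the graphs of two continuous functions $\psi_1<\psi_2$ from $\Sigma$ to $I$. It is strictly trapping if $\overline{F(\Pi)}\subset\Pi$ and strictly inverse trapping if $\overline{\Pi}\subset F(\Pi)$. A closed set $K\subset X$ is a bony graph if it intersects $\mu_\Sigma$-a.e. fiber $\{\omega\}\times I$ in a single point and every other fiber in a non-degenerate segment (a bone). The maximal attractor of a strictly trapping strip $\Pi$ is $\bigcap_{n\ge1}F^n(\Pi)$; the maximal repeller of a strictly inverse trapping strip $\Pi$ is $\bigcap_{n\ge1}F^{-n}(\Pi)$. The set $\mathcal I$. By a theorem of Kleptsyn and Volk there is an open and dense (in any $C^r$-topology, $r\ge1$) subset $\mathcal I$ of the set of all step skew products $F:X\to X$, $F(\omega,x)=(\sigma\omega,f_{\omega_0}(x))$, over $(\Sigma,\sigma)$ with fiber the segment $I$ whose fiber maps $f_j:I\to I$ are orientation preserving $C^r$-diffeomorphisms onto their images, such that every $F\in\mathcal I$ satisfies: (1) $X$ is covered by a union of finitely many strictly trapping and strictly inverse trapping strips. (2) The maximal attractor in every one of these trapping strips is a bony graph, and the maximal repeller in every one of these inverse trapping strips is a bony graph. (3) In every one of these strips there is a unique ergodic invariant measure that projects to $\mu_\Sigma$; it is obtained by lifting $\mu_\Sigma$ to the maximal attractor (respectively repeller) viewed as the graph of a $\mu_\Sigma$-almost everywhere defined measurable function. It is an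 SRB-measure in the strip: for $\mu_X$-a.e. point $p$ of a trapping strip the measures $\frac1n\sum_{j=0}^{n-1}\delta_{F^j(p)}$ converge weakly to it (for inverse trapping strips, with $F^{-1}$ in place of $F$). (4) The fiberwise Lyapunov exponent of this measure, i.e. $\int_\Sigma\ln f'_{\omega_0}(\phi(\omega))\,d\mu_\Sigma$, where $\phi$ is the almost everywhere defined function from (3), is negative for trapping strips and positive for inverse trapping ones. Notation. For $F\in\mathcal I$, $\Pi_1,\dots,\Pi_l$ are the strictly trapping strips in (1), and $\Gamma_i\subset\Pi_i$ is the graph of the almost everywhere defined function from $\Sigma$ to $I$ which together with the corresponding bones forms the maximal attractor of $\Pi_i$ (so $\Gamma_i$ consists of the points of the maximal attractor lying in those fibers which meet it in a single point). *)

(* Defs.v *)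
From HB Require Import structures.
From mathcomp Require Import all_boot all_order all_algebra.
From mathcomp Require Import all_classical all_reals all_analysis.

Set Implicit Arguments.
Unset Strict Implicit.
Unset Printing Implicit Defensive.

Import Order.TTheory GRing.Theory Num.Theory.
Import numFieldNormedType.Exports.

Local Open Scope classical_set_scope.
Local Open Scope ring_scope.

(** ** Biinfinite sequences over the alphabet {0, .., N} *)

(* The phantom parameter [R] only serves to attach the real-valued distance
   below to the type, which thus carries the topology of this distance.  *)
Definition biseq (R : realType) (N : nat) : Type := int -> 'I_N.+1.

HB.instance Definition _ (R : realType) (N : nat) :=
  gen_eqMixin (biseq R N).
HB.instance Definition _ (R : realType) (N : nat) :=
  gen_choiceMixin (biseq R N).
HB.instance Definition _ (R : realType) (N : nat) :=
  isPointed.Build (biseq R N) (fun=> ord0).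

Section biseq_distance.
Context {R : realType} {N : nat}.
Implicit Types w v u : biseq R N.

Definition differ_at w v (m : nat) : bool :=
  (w m%:Z != v m%:Z) || (w (- m%:Z) != v (- m%:Z)).

(* 2^-m with m = min {|n| : w n <> v n}, and 0 if w = v *)
Definition biseq_dist w v : R :=
  if pselect (exists m, differ_at w v m) is left ex then 2^-1 ^+ ex_minn ex
  else 0.

Lemma biseq_dist_ge0 w v : 0 <= biseq_dist w v.
Proof.
by rewrite /biseq_dist; case: pselect => // ex; rewrite exprn_ge0 ?invr_ge0.
Qed.

Lemma differ_atxx w m : differ_at w w m = false.
Proof. by rewrite /differ_at !eqxx. Qed.

Lemma biseq_distxx w : biseq_dist w w = 0.
Proof.
rewrite /biseq_dist; case: pselect => // ex; exfalso.
by case: ex => m; rewrite differ_atxx.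
Qed.

Lemma biseq_dist_eq0 w v : biseq_dist w v = 0 -> w = v.
Proof.
rewrite /biseq_dist; case: pselect => [ex /eqP|nex _].
  by rewrite expf_eq0 invr_eq0 pnatr_eq0 andbF.
apply/funext => n; apply/eqP/negPn/negP => wvn; apply: nex.
exists `|n|%N; rewrite /differ_at; case: n wvn => n /= wvn; first by rewrite wvn.
by rewrite -NegzE wvn orbT.
Qed.

Lemma biseq_dist_sym w v : biseq_dist w v = biseq_dist v w.
Proof.
have d_sym : differ_at w v = differ_at v w.
  by apply/funext => m; rewrite /differ_at !(eq_sym (w _)).
rewrite /biseq_dist d_sym.
by case: pselect => // ex; congr (_ ^+ _); apply: eq_ex_minn.
Qed.

Lemma biseq_dist_le w v m : differ_at w v m -> 2^-1 ^+ m <= biseq_dist w v.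
Proof.
move=> dm; rewrite /biseq_dist; case: pselect => [ex|]; last by case; exists m.
case: ex_minnP => k _ /(_ _ dm) km.
by rewrite ler_wiXn2l // ?invr_ge0 // invf_le1 // ler1n.
Qed.

Lemma biseq_dist_triangle v w u :
  biseq_dist w u <= biseq_dist w v + biseq_dist v u.
Proof.
rewrite {1}/biseq_dist; case: pselect => [ex|_]; last first.
  by rewrite addr_ge0 ?biseq_dist_ge0.
case: ex_minnP => m dm _.
have [wv|/negPf wv] := boolP (differ_at w v m).
  by rewrite ler_wpDr ?biseq_dist_ge0 ?biseq_dist_le.
rewrite ler_wpDl ?biseq_dist_ge0 // biseq_dist_le //.
move: wv dm; rewrite /differ_at => /negbT; rewrite negb_or !negbK.
by move=> /andP[/eqP-> /eqP->].
Qed.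

End biseq_distance.

HB.instance Definition _ (R : realType) (N : nat) :=
  isMetric.Build R (biseq R N) biseq_distxx biseq_dist_eq0 biseq_dist_sym
    biseq_dist_triangle.

(* Borel sigma-algebra *)
HB.instance Definition _ (R : realType) (N : nat) :=
  isMeasurable.Build default_measure_display (biseq R N)
    (@sigma_algebra0 _ setT open) (@sigma_algebraC _ open)
    (@sigma_algebra_bigcup _ setT open).

(** ** Topological Markov chains *)

Section markov_chain.
Context {R : realType} {N : nat}.

Definition bishift (w : biseq R N) : biseq R N := fun n => w (n + 1).

Definition Sigma (A : rel 'I_N.+1) : set (biseq R N) :=
  [set w | forall n, A (w n) (w (n + 1))].

Definition transitive_chain (A : rel 'I_N.+1) : Prop :=
  forall i j, exists s, path A i (rcons s j).

(* [p] is the stationary distribution, [P] the transition probabilities *)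
Definition markov_measure (A : rel 'I_N.+1) (mu : probability (biseq R N) R)
    : Prop :=
  exists (p : 'I_N.+1 -> R) (P : 'I_N.+1 -> 'I_N.+1 -> R),
    [/\ (forall i, 0 <= p i) /\ \sum_i p i = 1,
        (forall i j, 0 <= P i j) /\ (forall i, \sum_j P i j = 1),
        forall j, \sum_i p i * P i j = p j,
        forall i j, A i j = (0 < P i j) &
        forall (n : int) (m : nat) (u : nat -> 'I_N.+1),
          mu [set w | forall k : nat, (k <= m)%N -> w (n + k%:Z) = u k] =
          (p (u 0%N) * \prod_(0 <= k < m) P (u k) (u k.+1))%:E].

End markov_chain.

(** ** Invariant and ergodic measures of a map [T] from [D] to itself *)

Section ergodicity.
Context {d : measure_display} {X : measurableType d} {R : realType}.
Implicit Types (D : set X) (T : X -> X) (m : set X -> \bar R).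

Definition invariant_measure D T m : Prop :=
  forall B, measurable B -> B `<=` D -> m (D `&` T @^-1` B) = m B.

Definition ergodic_measure D T m : Prop :=
  forall B, measurable B -> B `<=` D -> D `&` T @^-1` B = B ->
    m B = 0%E \/ m B = 1%E.

End ergodicity.

(** ** Functions of class C^r on a subset of the line *)

Section smoothness.
Context {R : realType}.
Implicit Types (D : set R) (f g : R -> R).

(* Derivatives are taken within [D], hence are one-sided at the endpoints when
   [D] is a segment. *)
Definition diff_quotient f (x y : R) : R := (f y - f x) / (y - x).

Definition derivable_in D f (x : R) : Prop :=
  cvg (diff_quotient f x @ within D x^').

Definition derive_in D f (x : R) : R := lim (diff_quotient f x @ within D x^').

Definition Cr_in (r : nat) D f : Prop :=
  (forall k, (k < r)%N -> forall x, D x ->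
     derivable_in D (iter k (derive_in D) f) x) /\
  (forall k, (k <= r)%N -> {within D, continuous (iter k (derive_in D) f)}).

Definition fiber_diffeo (r : nat) D f : Prop :=
  [/\ f @` D `<=` D,
      forall x y, D x -> D y -> x < y -> f x < f y,
      Cr_in r D f &
      exists2 g, forall x, D x -> g (f x) = x & Cr_in r (f @` D) g].

End smoothness.

(** ** Step skew products over the chain, with fiber the segment `[a, b] *)

(* A step skew product is given by its tuple of fiber maps [f]. Fiber maps and
   functions on Sigma are represented by total functions; only their values on
   `[a, b], resp. Sigma, are relevant. *)
Section skew_products.
Context {R : realType} {N : nat}.
Context (A : rel 'I_N.+1) (mu : probability (biseq R N) R) (a b : R).

Local Notation segI := (`[a, b]%classic : set R).
Local Notation Sig := (@Sigma R N A).

(* [phase] is closed in the ambient product, so closed sets, closures and limit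
   sets of its subsets may be taken there. *)
Definition phase : set (biseq R N * R) := Sig `*` segI.

(* mu x Leb, without restricting Leb to the segment: statements that hold almost
   everywhere are always relativized to subsets of [phase]. *)
Definition mu_phase :
    {measure set (biseq R N * measurableTypeR R)%type -> \bar R} :=
  (mu \x (@lebesgue_measure R))%E.

Implicit Types (f g : 'I_N.+1 -> R -> R) (Pi K : set (biseq R N * R))
  (phi : biseq R N -> R) (p q : biseq R N * R).

Definition step_skew_product (r : nat) f : Prop :=
  forall j, fiber_diffeo r segI (f j).

Definition skew_map f (p : biseq R N * R) : biseq R N * R :=
  (bishift p.1, f (p.1 0) p.2).

(* inverse of [skew_map f : phase -> phase] on its image *)
Definition skew_inv f p : biseq R N * R :=
  xget p (phase `&` skew_map f @^-1` [set p]).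

Definition Cr_close (r : nat) (e : R) f g : Prop :=
  forall j k x, (k <= r)%N -> segI x ->
    `|iter k (derive_in segI) (f j) x - iter k (derive_in segI) (g j) x| < e.

Definition Cr_open (r : nat) (U : set ('I_N.+1 -> R -> R)) : Prop :=
  forall f, U f -> exists2 e, 0 < e &
    forall g, step_skew_product r g -> Cr_close r e f g -> U g.

Definition Cr_dense (r : nat) (U : set ('I_N.+1 -> R -> R)) : Prop :=
  forall f, step_skew_product r f -> forall e, 0 < e ->
    exists2 g, U g & Cr_close r e f g.

(** *** Milnor attractor *)

Definition omega_limit f p : set (biseq R N * R) :=
  cluster ((fun n => iter n (skew_map f) p) @ \oo).

Definition milnor_attractor f : set (biseq R N * R) :=
  \bigcap_(K in [set K | [/\ closed K, K `<=` phase &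
      {ae mu_phase, forall p, phase p -> omega_limit f p `<=` K}]]) K.

(** *** Strips and bony graphs *)

Definition strip Pi : Prop :=
  exists psi1 psi2 : biseq R N -> R,
    [/\ {within Sig, continuous psi1}, {within Sig, continuous psi2},
        forall w, Sig w -> [/\ segI (psi1 w), segI (psi2 w) & psi1 w < psi2 w]
      & Pi = [set p | Sig p.1 /\ psi1 p.1 <= p.2 <= psi2 p.1]].

Definition strictly_trapping f Pi : Prop := closure (skew_map f @` Pi) `<=` Pi.

Definition strictly_inverse_trapping f Pi : Prop :=
  closure Pi `<=` skew_map f @` Pi.

Definition maximal_attractor f Pi : set (biseq R N * R) :=
  \bigcap_(n in [set n | (1 <= n)%N]) (iter n (skew_map f) @` Pi).

Definition maximal_repeller f Pi : set (biseq R N * R) :=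
  \bigcap_(n in [set n | (1 <= n)%N]) (phase `&` iter n (skew_map f) @^-1` Pi).

Definition fiber_of K (w : biseq R N) : set R := [set x | K (w, x)].

Definition bony_graph K : Prop :=
  [/\ closed K, K `<=` phase,
      {ae mu, forall w, Sig w -> exists x, fiber_of K w = [set x]} &
      forall w, Sig w -> (exists x, fiber_of K w = [set x]) \/
        (exists u v, u < v /\ fiber_of K w = `[u, v]%classic)].

(* the part of [K] over the fibers met by [K] in a single point *)
Definition graph_part K : set (biseq R N * R) :=
  [set p | Sig p.1 /\ fiber_of K p.1 = [set p.2]].

(** *** Invariant measures of strips *)

Definition strip_measure f Pi
    (nu : probability (biseq R N * measurableTypeR R)%type R) : Prop :=
  [/\ nu Pi = 1%E, invariant_measure phase (skew_map f) nu,
      ergodic_measure phase (skew_map f) nu &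
      forall B : set (biseq R N), measurable B -> nu (fst @^-1` B) = mu B].

(* [K] is, over almost every fiber, the graph of [phi]. The almost everywhere
   defined function is represented by a total measurable extension. *)
Definition graph_function K phi : Prop :=
  [/\ measurable_fun setT phi, forall w, Sig w -> segI (phi w) &
      {ae mu, forall w, Sig w -> fiber_of K w = [set phi w]}].

Definition lifts phi
    (nu : probability (biseq R N * measurableTypeR R)%type R) : Prop :=
  forall B : set (biseq R N * measurableTypeR R), measurable B ->
    nu B = mu [set w | B (w, phi w)].

(* the averages are the integrals of [g] with respect to the measures
   n^-1 (delta_p + delta_(T p) + ... + delta_(T^(n-1) p)) *)
Definition empirical_cvg (T : biseq R N * R -> biseq R N * R) p
    (nu : probability (biseq R N * measurableTypeR R)%type R) : Prop :=
  forall g : biseq R N * R -> R, {within phase, continuous g} ->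
    n%:R^-1 * (\sum_(0 <= j < n) g (iter j T p)) @[n --> \oo] -->
      \int[nu]_(q in phase) g q.

Definition lyapunov f phi : R :=
  \int[mu]_(w in Sig) ln (derive_in segI (f (w 0)) (phi w)).

(* Unique ergodic measure of the strip, with [K] its maximal attractor or
   repeller and [T] the direct or inverse dynamics. *)
Definition strip_statistics f Pi K (T : biseq R N * R -> biseq R N * R)
    (sign_condition : R -> Prop) : Prop :=
  exists phi (nu : probability (biseq R N * measurableTypeR R)%type R),
    [/\ graph_function K phi /\ lifts phi nu,
        strip_measure f Pi nu,
        forall nu', strip_measure f Pi nu' ->
          forall B, measurable B -> nu' B = nu B,
        {ae mu_phase, forall p, Pi p -> empirical_cvg T p nu} &
        sign_condition (lyapunov f phi)].

Definition kleptsyn_volk f (l m : nat)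
    (Pi : 'I_l -> set (biseq R N * R)) (Pi' : 'I_m -> set (biseq R N * R))
    : Prop :=
  [/\ (forall i, strip (Pi i) /\ strictly_trapping f (Pi i)) /\
      (forall i, strip (Pi' i) /\ strictly_inverse_trapping f (Pi' i)),
      phase `<=` \bigcup_i Pi i `|` \bigcup_i Pi' i,
      (forall i, bony_graph (maximal_attractor f (Pi i))) /\
      (forall i, bony_graph (maximal_repeller f (Pi' i))),
      forall i, strip_statistics f (Pi i) (maximal_attractor f (Pi i))
        (skew_map f) (fun lambda => lambda < 0) &
      forall i, strip_statistics f (Pi' i) (maximal_repeller f (Pi' i))
        (skew_inv f) (fun lambda => 0 < lambda)].

End skew_products.

(* Main.v *)
Require Import Defs.
From HB Require Import structures.
From mathcomp Require Import all_boot all_order all_algebra.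
From mathcomp Require Import all_classical all_reals all_analysis.
From mathcomp Require Import measurable_realfun zify ring lra.
Import Order.TTheory GRing.Theory Num.Theory.
Import numFieldNormedType.Exports.
Local Open Scope classical_set_scope.
Local Open Scope ring_scope.

(** Write F for the skew product. In a trapping strip the
    image of the strip under F^n meets the fiber over w in the segment between
    [push f n psi1 w] and [push f n psi2 w], the images of the two boundary
    graphs. These segments decrease with n, and over almost every w they shrink
    to a point because the maximal attractor has one-point fibers there
    ([width_cvg0]); by dominated convergence their mean length tends to 0
    ([width_integral_cvg0]).

    The heart of the proof is [empirical_contraction]. Let p be a point whose
    time averages converge to the SRB measure nu, and let q be any point of the
    strip on the same fiber. The distance between the n-th iterates is multiplied
    at each step by a difference quotient of a fiber map. Its logarithm is at most
    ln f' at the iterate of p, plus a small constant, plus a multiple of the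
    distance itself ([fiber_dist_le]), and after M steps that distance is at most
    the length of the M-th image of the strip, a continuous function of the base
    point. So the convergence of the time averages, applied to the logarithm of
    the derivative and to this length, shows that the logarithms of the factors
    have an average limit close to the Lyapunov exponent, hence negative: the
    distance tends to 0. As almost every fiber contains such a point p, all points
    of the strip on almost every fiber are asymptotic to each other
    ([ae_fiber_contraction]), in particular to the point of the graph on that
    fiber, whose orbit stays in the graph.

    This gives the inclusion of the attractor in the closure of the graphs for the
    points in trapping strips. A point in an inverse trapping strip leaves it
    unless it belongs to the maximal repeller, which is null since almost all of
    its fibers are single points, and it never returns; so almost every orbit ends
    in a trapping strip. The full measure of fibers with good behaviour is not
    lost on the way, because it is a condition on the base point alone and the
    shift preserves the measure ([ae_orbit]).

    Conversely, let q be a point of a graph, over eta. The orbit of a typical p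
    visits each cylinder around eta infinitely often, because the time averages of
    its indicator tend to its measure, which is positive ([cylinder_visits]). At
    these times the fiber of the attractor is close to q, the attractor being
    closed with a one-point fiber over eta, and p is close to the attractor by
    contraction. So q is a limit point of the orbit of p
    ([graph_part_omega_limit]). *)

Set Implicit Arguments.
Unset Strict Implicit.
Unset Printing Implicit Defensive.

(** * The sequence space *)

Section sequence_space.
Context {R : realType} {N : nat}.
Implicit Types (w v : biseq R N) (A : rel 'I_N.+1).

Lemma near_agree w (M : nat) :
  \forall v \near w, forall n : int, (`|n| <= M)%N -> v n = w n.
Proof.
have e0 : 0 < 2^-1 ^+ M :> R by rewrite exprn_gt0 // invr_gt0.
near=> v => n nM.
have : ball w (2^-1 ^+ M) v by near: v; exact: nbhsx_ballx.
rewrite ballEmdist /=; apply: contraTeq => vn; rewrite -leNgt.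
apply: (@le_trans _ _ (2^-1 ^+ `|n|%N)).
  by rewrite ler_wiXn2l // ?invr_ge0 // invf_le1 // ler1n.
apply: biseq_dist_le; rewrite /differ_at.
by case: n nM vn => n /= _; rewrite ?NegzE eq_sym => ->; rewrite ?orbT.
Unshelve. all: by end_near. Qed.

Lemma nbhs_agree w (B : set (biseq R N)) : nbhs w B ->
  exists M, forall v, (forall n : int, (`|n| <= M)%N -> v n = w n) -> B v.
Proof.
move=> /nbhs_ballP[e /= e0 eB].
have [M Me] : exists M, 2^-1 ^+ M < e.
  have /cvgrPdist_lt/(_ e e0)[M _ HM] :
      (2^-1 : R) ^+ n @[n --> \oo] --> (0 : R).
    by apply: cvg_expr; rewrite ger0_norm ?invr_ge0 // invf_lt1 // ltr1n.
  exists M; have := HM M (leqnn M).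
  by rewrite sub0r normrN ger0_norm // exprn_ge0 // invr_ge0.
exists M => v vw; apply: eB; rewrite ballEmdist /=.
apply: le_lt_trans Me; change (biseq_dist w v <= 2^-1 ^+ M).
rewrite /biseq_dist; case: pselect => [ex|_]; last first.
  by rewrite exprn_ge0 // invr_ge0.
case: ex_minnP => k + _; rewrite /differ_at => dk.
rewrite ler_wiXn2l // ?invr_ge0 ?invf_le1 ?ler1n //.
rewrite leqNgt; apply/negP => kM; move: dk.
have vk (n : int) : `|n|%N = k -> v n = w n by move=> nk; rewrite vw // nk ltnW.
by rewrite (vk k%:Z) // (vk (- k%:Z)) ?abszN // !eqxx.
Qed.

Lemma near_coord w (n : int) : \forall v \near w, v n = w n.
Proof. by near=> v; near: v; apply: filterS (near_agree w `|n|) => v; apply.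
Unshelve. all: by end_near. Qed.

Lemma Sigma_closed A : closed (Sigma A : set (biseq R N)).
Proof.
move=> w clw n.
have [v [Sv [v0 v1]]] := clw _ (filterI (near_coord w n) (near_coord w (n + 1))).
by rewrite -v0 -v1.
Qed.

Lemma coord_open (n : int) (s : 'I_N.+1) : open [set w : biseq R N | w n = s].
Proof.
rewrite openE => w /= <-; exact: near_coord.
Qed.

Definition bishiftV (w : biseq R N) : biseq R N := fun n => w (n - 1).

Lemma bishiftK : cancel (bishift (R:=R) (N:=N)) bishiftV.
Proof. by move=> w; apply/funext => n; rewrite /bishiftV /bishift subrK. Qed.

Lemma bishiftVK : cancel bishiftV (bishift (R:=R) (N:=N)).
Proof. by move=> w; apply/funext => n; rewrite /bishiftV /bishift addrK. Qed.

Lemma Sigma_bishift A w : Sigma A w -> Sigma A (bishift w).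
Proof. by move=> Sw n; exact: Sw. Qed.

Lemma Sigma_bishiftV A w : Sigma A w -> Sigma A (bishiftV w).
Proof. by move=> Sw n; rewrite /bishiftV addrAC. Qed.

Lemma bishiftV_continuous : continuous bishiftV.
Proof.
move=> w B /nbhs_agree[M MB]; rewrite /nbhs /=.
apply: filterS (near_agree w M.+1) => v vw; apply: MB => n nM.
by rewrite /bishiftV vw //; lia.
Qed.

Lemma biseq_open_measurable (B : set (biseq R N)) : open B -> measurable B.
Proof. exact: sub_sigma_algebra. Qed.

Lemma biseq_closed_measurable (B : set (biseq R N)) : closed B -> measurable B.
Proof.
move=> cB; rewrite -[B]setCK; apply: measurableC.
by apply: biseq_open_measurable; exact: closed_openC.
Qed.

Lemma Sigma_measurable A : measurable (Sigma A : set (biseq R N)).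
Proof. by apply: biseq_closed_measurable; exact: Sigma_closed. Qed.

Lemma within_continuous_measurable (D : set (biseq R N)) (f : biseq R N -> R) :
  measurable D -> {within D, continuous f} -> measurable_fun D f.
Proof.
move=> mD /continuousP cf; apply: (measurability _ (RGenOpens.measurableE R)).
move=> _ [_ [a [b ->] <-]].
have oab : open (`]a, b[%classic : set R) by exact: interval_open.
have /open_subspaceP[V oV VE] := cf _ oab.
rewrite setIC -VE; apply: measurableI => //; exact: biseq_open_measurable.
Qed.

End sequence_space.

(** * Fiber maps *)

Section coarse_lipschitz.
Context {R : realType}.
Implicit Types (a b : R) (g : R -> R).

(** On a compact segment a continuous function is Lipschitz at all scales larger
    than its modulus of continuity for [e]; compactness makes this scale
    uniform. *)
Lemma continuous_coarse_lipschitz a b g (e : R) : a <= b ->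
  {within `[a, b], continuous g} -> 0 < e ->
  exists2 C, 0 <= C & forall x y, `[a, b]%classic x -> `[a, b]%classic y ->
    `|g x - g y| <= e + C * `|x - y|.
Proof.
move=> ab cg e0.
have [cM cMab gM] := EVT_max ab cg; have [cm cmab gm] := EVT_min ab cg.
pose V := g cM - g cm.
have gV x y : `[a, b]%classic x -> `[a, b]%classic y -> `|g x - g y| <= V.
  move=> /= xab yab; have := (gM x xab, gM y yab, gm x xab, gm y yab).
  by move=> [[[? ?] ?] ?]; rewrite ler_norml /V; apply/andP; split; lra.
have V0 : 0 <= V by have := gV _ _ cMab cMab; rewrite subrr normr0.
have /compact_near_coveringP/near_covering_withinP cov := @segment_compact R a b.
have key : \forall C \near +oo, `[a, b]%classic `<=` [set x | forall y,
    `[a, b]%classic y -> `|g x - g y| <= e + C * `|x - y|].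
  apply: (cov _ _ (fun C x => forall y, `[a, b]%classic y ->
    `|g x - g y| <= e + C * `|x - y|)) => x0 x0ab.
  have e20 : 0 < e / 2 by rewrite divr_gt0.
  have /subspace_continuousP/(_ x0 x0ab)/cvgrPdist_lt/(_ _ e20) := cg.
  rewrite /prop_near1 /within /= => /nbhs_ballP[d /= d0 dg].
  (* Points at distance at least d / 2 are handled by the oscillation V. *)
  exists (ball x0 (d / 2), [set C | 4 * V / d <= C]) => /=.
    split; first by apply: nbhsx_ballx; rewrite divr_gt0.
    by apply: nbhs_pinfty_ge; rewrite num_real.
  move=> [x C] /= [x0x VC] xab y yab.
  have [x0y|x0y] := ltP `|x0 - y| d.
    have gx : `|g x0 - g x| < e / 2.
      by apply: dg => //; apply: le_ball x0x;
        rewrite ler_pdivrMr // ler_peMr ?ler1n // ltW.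
    have gy : `|g x0 - g y| < e / 2 by apply: dg.
    have C0 : 0 <= C by apply: le_trans VC; rewrite divr_ge0 ?mulr_ge0 // ltW.
    have CC : 0 <= C * `|x - y| by rewrite mulr_ge0.
    move: gx gy; rewrite !ltr_norml => /andP[? ?] /andP[? ?].
    by rewrite ler_norml; apply/andP; split; lra.
  apply: (le_trans (gV _ _ xab yab)).
  have xy : d / 2 <= `|x - y|.
    have := ler_distD x x0 y; move: x0x; rewrite /ball /= => x0x.
    lra.
  have : 4 * V / d * (d / 2) <= C * `|x - y|.
    by rewrite ler_pM // ?divr_ge0 ?mulr_ge0 // ltW.
  have -> : 4 * V / d * (d / 2) = 2 * V by field; rewrite gt_eqF.
  by move=> ?; lra.
have [C [C0 HC]] : exists C, 0 <= C /\ `[a, b]%classic `<=` [set x | forall y,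
    `[a, b]%classic y -> `|g x - g y| <= e + C * `|x - y|].
  have : \forall C \near +oo, 0 <= C /\ `[a, b]%classic `<=` [set x | forall y,
      `[a, b]%classic y -> `|g x - g y| <= e + C * `|x - y|].
    by apply: filterI => //; apply: nbhs_pinfty_ge; rewrite num_real.
  by move=> /filter_ex.
by exists C => // x y xab yab; exact: HC.
Qed.

End coarse_lipschitz.

Section fiber_maps.
Context {R : realType} (a b : R) (ab : a < b).
Local Notation D := (`[a, b]%classic : set R).
Implicit Types (f : R -> R).

Lemma segment_within_dnbhs_proper (x : R) : D x -> ProperFilter (within D x^').
Proof.
move=> Dx; apply: Build_ProperFilter_ex => B /nbhs_ballP[d /= d0 dB].
have : exists2 y, (ball x d y /\ y != x) & D y.
  move: Dx; rewrite /= in_itv /= => /andP[ax xb].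
  have [xb'|xb'] := ltP x b.
    pose m := Num.min (d / 2) (b - x).
    have m0 : 0 < m by rewrite lt_min divr_gt0 // subr_gt0.
    have md : m <= d / 2 by rewrite ge_min lexx.
    have mb : m <= b - x by rewrite ge_min lexx orbT.
    exists (x + m); last by rewrite in_itv /=; apply/andP; split; lra.
    split; last by rewrite gt_eqF // ltrDl.
    by rewrite /ball /= ltr_norml; apply/andP; split; lra.
  pose m := Num.min (d / 2) (b - a).
  have m0 : 0 < m by rewrite lt_min divr_gt0 // subr_gt0.
  have md : m <= d / 2 by rewrite ge_min lexx.
  have mb : m <= b - a by rewrite ge_min lexx orbT.
  exists (x - m); last by rewrite in_itv /=; apply/andP; split; lra.
  split; last by rewrite lt_eqF // ltrBlDr ltrDl.
  by rewrite /ball /= ltr_norml; apply/andP; split; lra.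
by move=> [y [xy yx] Dy]; exists y; exact: dB.
Qed.

Variables (r : nat) (f : R -> R).
Hypotheses (r1 : (1 <= r)%N) (fD : fiber_diffeo r D f).

Lemma fiber_diffeo_seg x : D x -> D (f x).
Proof. by move=> Dx; case: fD => + _ _ _; apply; exists x. Qed.

Lemma fiber_diffeo_lt x y : D x -> D y -> x < y -> f x < f y.
Proof. by case: fD => _ + _ _; apply. Qed.

Lemma fiber_diffeo_le x y : D x -> D y -> x <= y -> f x <= f y.
Proof.
move=> Dx Dy; rewrite le_eqVlt => /orP[/eqP->//|xy].
by apply: ltW; exact: fiber_diffeo_lt.
Qed.

Lemma fiber_diffeo_inj x y : D x -> D y -> f x = f y -> x = y.
Proof.
move=> Dx Dy fxy; apply/eqP; rewrite eq_le !leNgt; apply/andP; split; apply/negP.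
  by move/(fiber_diffeo_lt Dy Dx); rewrite fxy ltxx.
by move/(fiber_diffeo_lt Dx Dy); rewrite fxy ltxx.
Qed.

Lemma fiber_diffeo_continuous : {within D, continuous f}.
Proof. by case: fD => _ _ [_ /(_ 0%N)] + _; apply. Qed.

Lemma fiber_derive_continuous : {within D, continuous (derive_in D f)}.
Proof. by case: fD => _ _ [_ /(_ 1%N)] + _; apply. Qed.

Lemma diff_quotient_cvg x : D x ->
  diff_quotient f x y @[y --> within D x^'] --> derive_in D f x.
Proof. by move=> Dx; case: fD => _ _ [/(_ 0%N r1 x Dx)]. Qed.

(** The chain rule applied to the inverse, which is of class C^1 by
    assumption, prevents the derivative from vanishing. *)
Lemma fiber_derive_gt0 x : D x -> 0 < derive_in D f x.
Proof.
move=> Dx; have pD := segment_within_dnbhs_proper Dx.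
have nearD : \forall y \near within D x^', D y /\ y != x.
  by apply/nbhs_ballP; exists 1 => //= y _ yx Dy.
case: fD => _ _ _ [g gK [/(_ 0%N r1 (f x)) + _]].
have fDx : (f @` D) (f x) by exists x.
move=> /(_ fDx); rewrite /derivable_in /= => /cvg_ex[l gl].
have fx : f y @[y --> within D x^'] --> within (f @` D) (f x)^'.
  move=> B; rewrite /within /= /nbhs /= => fB.
  have /subspace_continuousP/(_ x Dx) := fiber_diffeo_continuous.
  move=> /(_ _ fB); rewrite /within /= /nbhs /= => fB'.
  rewrite /prop_near1 /within /= /dnbhs /within /=.
  apply: filterS fB' => y HB yx Dy; apply: HB => //; last by exists y.
  apply: contra_neqN yx => /eqP. exact: fiber_diffeo_inj.
have q0 : 0 <= derive_in D f x.
  apply: limr_ge.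
    by apply/cvg_ex; exists (derive_in D f x); exact: diff_quotient_cvg.
  apply: filterS nearD => y [Dy yx]; rewrite /diff_quotient.
  case: (ltgtP x y) yx => // xy _.
    by rewrite divr_ge0 // subr_ge0 ?ltW //; exact: fiber_diffeo_lt.
  rewrite -mulrNN -invrN !opprB.
  by rewrite divr_ge0 // subr_ge0 ?ltW //; exact: fiber_diffeo_lt.
rewrite lt_neqAle q0 andbT; apply/eqP => f0.
have : (diff_quotient f x y * diff_quotient g (f x) (f y)) @[y --> within D x^']
    --> (derive_in D f x * l).
  by apply: cvgM; [exact: diff_quotient_cvg | exact: cvg_comp fx gl].
rewrite -f0 mul0r => c0.
have c1 : (diff_quotient f x y * diff_quotient g (f x) (f y)) @[y --> within D x^']
    --> (1 : R).
  apply: cvg_near_cst; apply: filterS nearD => y [Dy yx].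
  rewrite /diff_quotient !gK // mulrA divfK ?divff ?subr_eq0 //.
  by apply: contra_neq yx; exact: fiber_diffeo_inj.
have := cvg_unique (@Rhausdorff R) c0 c1.
move=> /(_ (fmap_proper_filter _ pD)) /esym/eqP.
by rewrite oner_eq0.
Unshelve. all: by end_near. Qed.

Lemma fiber_is_derive x : x \in `]a, b[ -> is_derive x 1 f (derive_in D f x).
Proof.
move=> xab; have Dx : D x by rewrite /= subset_itv_oo_cc.
have lim1 : (h^-1 *: ((f \o shift x) (h *: 1) - f x)) @[h --> 0^']
    --> derive_in D f x.
  apply/cvgrPdist_lt => e e0.
  have /cvgrPdist_lt/(_ _ e0) := diff_quotient_cvg Dx.
  rewrite /prop_near1 /dnbhs /within /= => xe.
  have nD : \forall y \near x, D y.
    have : \forall y \near x, `]a, b[%classic y.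
      by apply: open_nbhs_nbhs; split => //; exact: interval_open.
    by apply: filterS => y; exact: subset_itv_oo_cc.
  have /nbhs_ballP[d /= d0 dP] : nbhs x (D `&` (fun t => t != x -> D t ->
    `|derive_in D f x - diff_quotient f x t| < e)) by exact: filterI.
  apply/nbhs_ballP; exists d => // h /= hd h0.
  have := dP (h + x).
  rewrite /ball /= sub0r normrN in hd *.
  rewrite opprD addrCA subrr addr0 normrN => /(_ hd)[Dh].
  rewrite /diff_quotient addrK => /(_ _ Dh).
  have -> : h^-1 *: (f (h%:A + x) - f x) = (f (h + x) - f x) / h.
    by rewrite /GRing.scale /= mulr1 mulrC.
  apply.
  by rewrite -subr_eq0 addrK.
apply: DeriveDef; last exact: cvg_lim lim1.
by apply/cvg_ex; exists (derive_in D f x).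
Qed.

Lemma fiber_mean_value x y : D x -> D y -> x < y ->
  exists2 c, x < c < y & f y - f x = derive_in D f c * (y - x).
Proof.
move=> Dx Dy xy.
have sub : `[x, y] `<=` D.
  move=> t /=; rewrite !in_itv /= => /andP[xt ty].
  move: Dx Dy; rewrite /= !in_itv /= => /andP[? ?] /andP[? ?].
  by apply/andP; split; lra.
have [||c] := @MVT R f (derive_in D f) x y xy.
- move=> t; rewrite in_itv /= => /andP[xt ty]; apply: fiber_is_derive.
  move: Dx Dy; rewrite /= !in_itv /= => /andP[? ?] /andP[? ?].
  by apply/andP; split; lra.
- by apply: continuous_subspaceW fiber_diffeo_continuous.
by rewrite in_itv /= => ? ?; exists c.
Qed.

Lemma ln_fiber_derive_continuous : {within D, continuous (fun x => ln (derive_in D f x))}.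
Proof.
apply: (@within_continuous_comp _ _ _ _ _ (@ln R)) fiber_derive_continuous => y.
rewrite inE => -[x Dx <-]; exact/continuous_ln/fiber_derive_gt0.
Qed.

(** The mean value theorem gives a derivative at an intermediate point; moving
    it to [x] costs the oscillation of the logarithm of the derivative, which
    is at most [e + C * `|x - y|] even for a merely continuous derivative. *)
Lemma fiber_dist_le (e : R) : 0 < e -> exists2 C, 0 <= C & forall x y, D x -> D y ->
  `|f x - f y| <=
    expR (ln (derive_in D f x) + e + C * `|x - y|) * `|x - y|.
Proof.
move=> e0.
have [C C0 HC] :=
  continuous_coarse_lipschitz (ltW ab) ln_fiber_derive_continuous e0.
exists C => // x y Dx Dy.
have key c : D c -> `|x - c| <= `|x - y| -> `|derive_in D f c| <=
    expR (ln (derive_in D f x) + e + C * `|x - y|).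
  move=> Dc cxy; have c0 := fiber_derive_gt0 Dc.
  rewrite (ger0_norm (ltW c0)) -[leLHS]lnK ?posrE // ler_expR.
  have := HC _ _ Dx Dc; rewrite /= ler_norml => /andP[+ _].
  have : C * `|x - c| <= C * `|x - y| by rewrite ler_wpM2l.
  move=> ? ?; lra.
have inD c u v : D u -> D v -> u < c < v -> D c.
  rewrite /= !in_itv /= => /andP[? ?] /andP[? ?] /andP[? ?].
  by apply/andP; split; lra.
case: (ltgtP x y) => [xy|yx|->]; last by rewrite !subrr normr0 mulr0.
  have [c /[dup] /andP[xc cy] /(inD _ _ _ Dx Dy) Dc E] := fiber_mean_value Dx Dy xy.
  rewrite distrC E normrM [`|y - x|]distrC ler_wpM2r // key //.
  by rewrite ![`|x - _|]distrC !gtr0_norm ?subr_gt0 //; lra.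
have [c /[dup] /andP[xc cy] /(inD _ _ _ Dy Dx) Dc E] := fiber_mean_value Dy Dx yx.
rewrite E normrM ler_wpM2r // key //.
by rewrite !gtr0_norm ?subr_gt0 //; lra.
Qed.

End fiber_maps.

(** * Iterated graphs and strips *)

Section within_continuity.
Context {T U V : topologicalType}.

Lemma within_continuous_comp_in (A : set T) (B : set U) (g : T -> U)
    (h : U -> V) : (forall t, A t -> B (g t)) -> {within A, continuous g} ->
  {within B, continuous h} -> {within A, continuous (h \o g)}.
Proof.
move=> AB /subspace_continuousP cg /subspace_continuousP ch.
apply/subspace_continuousP => t At W /(ch _ (AB _ At)).
rewrite /nbhs /= /within /= => /(cg _ At); rewrite /nbhs /= /within /=.
by apply: filterS => t' H At'; apply: H => //; exact: AB.
Qed.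

Lemma within_continuous_locally_cst (I : Type) (A : set T) (c : T -> I)
    (h : I -> T -> V) : (forall t, \forall t' \near t, c t' = c t) ->
  (forall i, {within A, continuous (h i)}) ->
  {within A, continuous (fun t => h (c t) t)}.
Proof.
move=> cc ch; apply/subspace_continuousP => t At W Wt.
have /subspace_continuousP/(_ t At W Wt) := ch (c t).
rewrite /nbhs /= /within /= => H.
apply: filterS (filterI H (cc t)) => t' [Ht' ct'] At'.
by change (W (h (c t') t')); rewrite ct'; exact: Ht'.
Qed.

End within_continuity.

Lemma near_fst {T U : topologicalType} (p : T * U) (Q : T -> Prop) :
  (\forall t \near p.1, Q t) -> \forall q \near p, Q q.1.
Proof. by move=> pQ; have := @cvg_fst _ _ (nbhs p.1) (nbhs p.2) _; apply. Qed.

Section skew_orbits.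
Context {R : realType} {N : nat} (A : rel 'I_N.+1) (a b : R) (r : nat).
Context (f : 'I_N.+1 -> R -> R) (ff : step_skew_product a b r f).
Local Notation D := (`[a, b]%classic : set R).
Local Notation F := (skew_map f).
Local Notation X := (phase A a b).
Implicit Types (w : biseq R N) (p q : biseq R N * R).

Lemma phase_closed : closed X.
Proof.
have -> : X = fst @^-1` (Sigma A : set (biseq R N)) `&` snd @^-1` D by [].
apply: closedI.
  by apply: closed_comp => [p _|]; [exact: cvg_fst|exact: Sigma_closed].
by apply: closed_comp => [p _|]; [exact: cvg_snd|exact: interval_closed].
Qed.

Lemma skew_map_phase p : X p -> X (F p).
Proof.
by move=> [Sp Dp]; split; [exact: Sigma_bishift|exact: fiber_diffeo_seg (ff _) _ Dp].
Qed.

Lemma iter_skew_phase n p : X p -> X (iter n F p).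
Proof. by move=> Xp; elim: n => //= n; exact: skew_map_phase. Qed.

Lemma iter_skew_fst n p : (iter n F p).1 = iter n bishift p.1.
Proof. by elim: n => //= n ->. Qed.

Lemma skew_map_inj p q : X p -> X q -> F p = F q -> p = q.
Proof.
move: p q => [w x] [v y] [/= _ Dx] [/= _ Dy] [] /(can_inj bishiftK) <-.
by move=> /(fiber_diffeo_inj (ff _) Dx Dy) <-.
Qed.

(** If [F p] lies in [P], it lies in [F @` P], and [p] lies in [P] by
    injectivity: a point that has left [P] never returns. *)
Lemma inverse_trapping_avoid (P : set (biseq R N * R)) n p : P `<=` X ->
  strictly_inverse_trapping f P -> X p -> ~ P p -> ~ P (iter n F p).
Proof.
move=> PX tP; elim: n p => //= n IH p Xp nPp; rewrite -iterS iterSr.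
apply: IH; first exact: skew_map_phase.
move=> /(@subset_closure _ P) /tP[q Pq /skew_map_inj qp]; apply: nPp.
by rewrite -qp //; exact: PX.
Qed.

(** The function whose graph is the image under the n-th iterate of the graph
    of [psi]. *)
Fixpoint push (n : nat) (psi : biseq R N -> R) w : R :=
  if n is m.+1 then f (w (- 1)) (push m psi (bishiftV w)) else psi w.

Section push.
Variables (psi : biseq R N -> R) (psiD : forall w, Sigma A w -> D (psi w)).

Lemma push_seg n w : Sigma A w -> D (push n psi w).
Proof.
elim: n w => [|n IH] w Sw /=; first exact: psiD.
by apply: (fiber_diffeo_seg (ff _)); apply: IH; exact: Sigma_bishiftV.
Qed.

Lemma push_continuous n : {within (Sigma A : set (biseq R N)), continuous psi} ->
  {within (Sigma A : set (biseq R N)), continuous (push n psi)}.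
Proof.
move=> cpsi; elim: n => //= n IH.
apply: (@within_continuous_locally_cst _ _ _ _ (fun w : biseq R N => w (- 1))
  (fun j w => f j (push n psi (bishiftV w)))) => [w|j].
  exact: near_coord.
apply: (@within_continuous_comp_in _ _ _ _ D (push n psi \o bishiftV) (f j)).
- by move=> w Sw; apply: push_seg; exact: Sigma_bishiftV.
- apply: (@within_continuous_comp_in _ _ _ _ (Sigma A : set (biseq R N))) IH.
    exact: Sigma_bishiftV.
  by apply: continuous_subspaceT; exact: bishiftV_continuous.
- exact: fiber_diffeo_continuous (ff j).
Qed.

End push.

Lemma push_le n psi psi' : (forall w, Sigma A w -> D (psi w)) ->
  (forall w, Sigma A w -> D (psi' w)) ->
  (forall w, Sigma A w -> psi w <= psi' w) ->
  forall w, Sigma A w -> push n psi w <= push n psi' w.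
Proof.
move=> psiD psiD' le; elim: n => //= n IH w Sw.
have Sw' := Sigma_bishiftV Sw.
apply: (fiber_diffeo_le (ff _)); try exact: push_seg.
exact: IH.
Qed.

Lemma pushD n m psi w : push (n + m) psi w = push n (push m psi) w.
Proof. by elim: n w => //= n IH w; rewrite IH. Qed.

End skew_orbits.

Section trapping_strip.
Context {R : realType} {N : nat} (A : rel 'I_N.+1) (a b : R) (r : nat).
Context (f : 'I_N.+1 -> R -> R) (ff : step_skew_product a b r f).
Local Notation D := (`[a, b]%classic : set R).
Local Notation F := (skew_map f).
Local Notation X := (phase A a b).
Local Notation Sig := (Sigma A : set (biseq R N)).
Context (psi1 psi2 : biseq R N -> R) (P : set (biseq R N * R)).
Hypotheses (c1 : {within Sig, continuous psi1})
  (c2 : {within Sig, continuous psi2}).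
Hypothesis psi12 : forall w, Sig w -> [/\ D (psi1 w), D (psi2 w) & psi1 w < psi2 w].
Hypothesis PE : P = [set p | Sig p.1 /\ psi1 p.1 <= p.2 <= psi2 p.1].
Hypothesis trapP : strictly_trapping f P.
Local Notation K := (maximal_attractor f P).
Local Notation lo n := (push f n psi1).
Local Notation hi n := (push f n psi2).
Implicit Types (w : biseq R N) (p q : biseq R N * R).

Let psi1D w : Sig w -> D (psi1 w). Proof. by move=> /psi12[]. Qed.
Let psi2D w : Sig w -> D (psi2 w). Proof. by move=> /psi12[]. Qed.
Let le12 w : Sig w -> psi1 w <= psi2 w. Proof. by move=> /psi12[_ _ /ltW]. Qed.

Lemma strip_phase : P `<=` X.
Proof.
move=> p; rewrite PE /= => -[Sp] /andP[p1 p2]; split => //.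
have [] := psi12 Sp; rewrite /= !in_itv /= => /andP[? _] /andP[_ ?] _.
by rewrite (le_trans _ p1) // (le_trans p2).
Qed.

Lemma strip_trap p : P p -> P (F p).
Proof. by move=> Pp; apply/trapP/subset_closure; exists p. Qed.

Lemma iter_strip n p : P p -> P (iter n F p).
Proof. by move=> Pp; elim: n => //= n; exact: strip_trap. Qed.

Lemma attractor_sub : K `<=` P.
Proof. by move=> p /(_ 1%N isT)[q Pq <-]; exact: iter_strip. Qed.

Lemma attractor_skew p : K p -> K (F p).
Proof.
move=> Kp [//|n] _; case: n => [|n].
  by exists p => //; exact: attractor_sub.
by have [q Pq <-] := Kp n.+1 isT; exists q.
Qed.

(** The fiber maps are increasing and continuous, so by the intermediate value
    theorem the image of a fiber of the strip is the whole segment between the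
    images of its endpoints. *)
Lemma iter_stripE n w x : Sig w ->
  (iter n F @` P) (w, x) <-> lo n w <= x <= hi n w.
Proof.
elim: n w x => [|n IH] w x Sw /=.
  rewrite PE; split => [[q [_ /=] qP qE]|wx]; last by exists (w, x).
  by move: qP; rewrite /= in qE; rewrite qE.
have Sw' := Sigma_bishiftV Sw.
have lD := push_seg ff psi1D n Sw'; have hD := push_seg ff psi2D n Sw'.
split=> [[[v y] Pvy E]|].
  set q := iter n F (v, y) in E.
  have q1 : q.1 = bishiftV w by case: E => <- _; rewrite bishiftK.
  have : (iter n F @` P) (bishiftV w, q.2).
    by exists (v, y) => //; rewrite -q1 -surjective_pairing.
  have [_ qD] : X q by apply: (iter_skew_phase ff); exact: strip_phase.
  move=> /(IH _ _ Sw') /andP[loq qhi].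
  case: E => _ <-; rewrite q1 {1 3}/bishiftV.
  have -> : bishiftV w 0 = w (- 1) by rewrite /bishiftV sub0r.
  by rewrite !(fiber_diffeo_le (ff _)).
have lh : lo n (bishiftV w) <= hi n (bishiftV w).
  by apply: (push_le ff n psi1D psi2D le12).
move=> lxh.
have sub : `[lo n (bishiftV w), hi n (bishiftV w)] `<=` D.
  move: lD hD; rewrite /= !in_itv /= => /andP[? ?] /andP[? ?] t /=.
  by rewrite !in_itv /= => /andP[? ?]; apply/andP; split; lra.
have cf : {within `[lo n (bishiftV w), hi n (bishiftV w)], continuous f (w (- 1))}.
  by apply: continuous_subspaceW (fiber_diffeo_continuous (ff _)).
have [|y] := @IVT R (f (w (-1))) _ _ x lh cf.
  have le : f (w (-1)) (lo n (bishiftV w)) <= f (w (-1)) (hi n (bishiftV w)).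
    by rewrite (fiber_diffeo_le (ff _)).
  by rewrite (min_idPl le) (max_idPr le).
rewrite in_itv /= => /(IH _ _ Sw')[q Pq Eq] fy.
exists q => //; rewrite Eq /skew_map /= bishiftVK.
by rewrite /bishiftV sub0r fy.
Qed.

Lemma lo_hi n w : Sig w -> lo n w <= hi n w.
Proof. exact: (push_le ff n psi1D psi2D le12). Qed.

Lemma push_step w : Sig w -> psi1 w <= lo 1 w /\ hi 1 w <= psi2 w.
Proof.
move=> Sw.
have key x : lo 1 w <= x <= hi 1 w -> psi1 w <= x <= psi2 w.
  move=> /(iter_stripE 1 _ Sw)[q Pq Eq].
  by have := iter_strip 1 Pq; rewrite Eq PE => -[].
have lh := lo_hi 1 Sw.
have := key (lo 1 w); rewrite lexx lh => /(_ isT)/andP[-> _].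
by have := key (hi 1 w); rewrite lexx lh => /(_ isT)/andP[_ ->].
Qed.

Lemma lo_nondecreasing w : Sig w ->
  {homo (fun n => lo n w) : n m / (n <= m)%N >-> n <= m}.
Proof.
move=> Sw; apply/nondecreasing_seqP => n; rewrite -addn1 pushD.
apply: (push_le ff n psi1D) Sw; first by move=> v; exact: (push_seg ff psi1D 1).
by move=> v /push_step[].
Qed.

Lemma hi_nonincreasing w : Sig w ->
  {homo (fun n => hi n w) : n m / (n <= m)%N >-> m <= n}.
Proof.
move=> Sw; apply/nonincreasing_seqP => n; rewrite -addn1 pushD.
apply: (push_le ff n _ psi2D) Sw; first by move=> v; exact: (push_seg ff psi2D 1).
by move=> v /push_step[].
Qed.

Lemma orbit_between m n p : (m <= n)%N -> P p ->
  lo m (iter n F p).1 <= (iter n F p).2 <= hi m (iter n F p).1.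
Proof.
move=> mn Pp; have [Sq _] := iter_skew_phase ff n (strip_phase Pp).
apply/(iter_stripE m _ Sq); exists (iter (n - m) F p); first exact: iter_strip.
by rewrite -iterD subnKC // -surjective_pairing.
Qed.

(** The boundaries are monotone in [n], and both limits belong to the fiber of
    the attractor, hence coincide. *)
Lemma width_cvg0 w z : Sig w -> fiber_of K w = [set z] ->
  hi n w - lo n w @[n --> \oo] --> 0.
Proof.
move=> Sw Kz.
have lohi n m : lo n w <= hi m w.
  apply: (@le_trans _ _ (lo (maxn n m) w)).
    by apply: lo_nondecreasing => //; rewrite leq_maxl.
  apply: (le_trans (lo_hi _ Sw)); apply: hi_nonincreasing => //.
  by rewrite leq_maxr.
have cl : lo n w @[n --> \oo] --> sup (range (fun n => lo n w)).
  apply: nondecreasing_cvgn; first exact: lo_nondecreasing.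
  by exists (hi 0%N w) => _ [n _ <-].
have ch : hi n w @[n --> \oo] --> inf (range (fun n => hi n w)).
  apply: nonincreasing_cvgn; first exact: hi_nonincreasing.
  by exists (lo 0%N w) => _ [n _ <-].
have Kfib x : (forall n, lo n w <= x <= hi n w) -> x = z.
  move=> H; have : fiber_of K w x by move=> n _; apply/(iter_stripE n x Sw).
  by rewrite Kz.
have supz : sup (range (fun n => lo n w)) = z.
  apply: Kfib => n; apply/andP; split.
    by apply: ub_le_sup; [exists (hi 0%N w) => _ [k _ <-]|exists n].
  by apply: ge_sup; [exists (lo 0%N w); exists 0%N|move=> _ [k _ <-]].
have infz : inf (range (fun n => hi n w)) = z.
  apply: Kfib => n; apply/andP; split.
    by apply: lb_le_inf; [exists (hi 0%N w); exists 0%N|move=> _ [k _ <-]].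
  by apply: ge_inf; [exists (lo 0%N w) => _ [k _ <-]|exists n].
rewrite supz in cl; rewrite infz in ch.
rewrite -(subrr z); exact: cvgB.
Qed.

Lemma width_bound n w : Sig w -> 0 <= hi n w - lo n w <= b - a.
Proof.
move=> Sw; have := lo_hi n Sw.
have := push_seg ff psi1D n Sw; have := push_seg ff psi2D n Sw.
rewrite /= !in_itv /= => /andP[? ?] /andP[? ?] ?; apply/andP; split; lra.
Qed.

Lemma width_continuous n : {within Sig, continuous (fun w => hi n w - lo n w)}.
Proof.
apply: within_continuousB; apply: (push_continuous ff) => //.
Qed.

End trapping_strip.

(** * Measures on the sequence space and on the phase space *)

Section base_measure.
Context {R : realType} {N : nat} (A : rel 'I_N.+1).
Context (mu : probability (biseq R N) R).
Local Notation Sig := (Sigma A : set (biseq R N)).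

Lemma bishift_continuous : continuous (@bishift R N).
Proof.
move=> w B /nbhs_agree[M MB]; rewrite /nbhs /=.
apply: filterS (near_agree w M.+1) => v vw; apply: MB => n nM.
by rewrite /bishift vw //; lia.
Qed.

Lemma bishift_measurable : measurable_fun setT (@bishift R N).
Proof.
have gen : @measurable _ (biseq R N) = <<s open >> by [].
apply: (measurability _ gen) => _ [B oB <-].
rewrite setTI; apply: biseq_open_measurable.
by move/continuousP : bishift_continuous; apply.
Qed.

(** The preimages of a null set under the iterates of the shift are null. *)
Lemma ae_orbit (Q : biseq R N -> Prop) :
  invariant_measure Sig bishift mu ->
  {ae mu, forall w, Sig w -> Q w} ->
  {ae mu, forall w, Sig w -> forall n, Q (iter n bishift w)}.
Proof.
move=> inv [Z [mZ Z0 ZQ]].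
pose B := fix B n := if n is m.+1 then Sig `&` bishift @^-1` B m else Sig `&` Z.
have mB n : measurable (B n) /\ B n `<=` Sig.
  elim: n => [|n [IH1 IH2]] /=.
    by split=> [|w []//]; apply: measurableI => //; exact: Sigma_measurable.
  split=> [|w []//]; apply: measurableI; first exact: Sigma_measurable.
  by rewrite -[X in measurable X]setTI; exact: bishift_measurable.
have B0 n : mu (B n) = 0%E.
  elim: n => [|n IH] /=.
    apply/eqP; rewrite -measure_le0 -Z0 le_measure ?inE //.
    by have [] := mB 0%N.
  by have [m1 m2] := mB n; rewrite inv.
have BS n w : Sig w -> B 0%N (iter n bishift w) -> B n w.
  elim: n w => // n IH w Sw; rewrite iterSr => /IH H; split => //.
  by apply: H; exact: Sigma_bishift.
have iterS n w : Sig w -> Sig (iter n bishift w).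
  by move=> Sw; elim: n => //= n; exact: Sigma_bishift.
apply: (@negligibleS _ _ _ _ (\bigcup_n B n)); last first.
  by apply: negligible_bigcup => n; apply/negligibleP; [exact: (mB n).1|exact: B0].
move=> w /= /not_implyP[Sw] /existsNP[n nQ]; exists n => //.
apply: BS => //; split; first exact: iterS.
by apply: ZQ => /= /(_ (iterS _ _ Sw)).
Qed.

Hypothesis mk : markov_measure A mu.

(** An inadmissible transition at a given place has probability zero, and there
    are countably many of them. *)
Lemma markov_Sigma : {ae mu, forall w, Sig w}.
Proof.
have [p [P [_ [P0 _] _ AP cyl]]] := mk.
have null (n : int) i j : ~~ A i j ->
    mu.-negligible [set w : biseq R N | w n = i /\ w (n + 1) = j].
  move=> Aij; apply/negligibleP.
    apply: biseq_open_measurable.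
    by apply: openI; exact: coord_open.
  have := cyl n 1%N (fun k => if k == 0%N then i else j).
  rewrite big_nat1 /=.
  have -> : P i j = 0.
    by apply/eqP; move: Aij; rewrite AP lt_neqAle P0 andbT negbK eq_sym.
  rewrite mulr0 => cyl0; apply: etrans cyl0; congr (mu _); apply/seteqP; split => w /=.
    by move=> [wi wj] [|[|//]] _ //=; rewrite addr0.
  by move=> H; split; [have := H 0%N isT; rewrite addr0|exact: (H 1%N isT)].
pose E (k : nat) := \big[setU/set0]_(ij : 'I_N.+1 * 'I_N.+1 | ~~ A ij.1 ij.2)
  ([set w : biseq R N | w k%:Z = ij.1 /\ w (k%:Z + 1) = ij.2] `|`
  [set w : biseq R N | w (- k%:Z) = ij.1 /\ w (- k%:Z + 1) = ij.2]).
apply: (@negligibleS _ _ _ _ (\bigcup_k E k)); last first.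
  apply: negligible_bigcup => k; rewrite /E.
  elim/big_ind: _ => [||[i j] /= Aij]; first exact: negligible_set0.
    exact: negligibleU.
  by apply: negligibleU; exact: null.
move=> w /= /existsNP[n] /negP nA; exists `|n|%N => //.
rewrite /E (bigD1 (w n, w (n + 1))) //=; left.
by case: n {nA} => n /=; [left|right; rewrite NegzE].
Qed.

(** Stationarity carries positivity along admissible transitions, so by
    transitivity every state has positive weight. *)
Lemma markov_cylinder_gt0 (w : biseq R N) (M : nat) : transitive_chain A ->
  Sig w -> (0 < mu [set v | forall n : int, (`|n| <= M)%N -> v n = w n])%E.
Proof.
move=> tr Sw; have [p [P [[p0 p1] [P0 _] st AP cyl]]] := mk.
have pA i j : A i j -> 0 < p i -> 0 < p j.
  move=> Aij pi; rewrite -st (bigD1 i) //= ltr_pwDl //.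
    by rewrite mulr_gt0 // -AP.
  by apply: sumr_ge0 => k _; rewrite mulr_ge0.
have ppath i s : path A i s -> 0 < p i -> 0 < p (last i s).
  elim: s i => //= j s IH i /andP[Aij pjs] pi.
  by apply: IH => //; exact: pA pi.
have [i pi] : exists i, 0 < p i.
  apply: contrapT => /forallNP np; have : \sum_i p i = 0.
    apply: big1 => i _; apply/eqP/negPn/negP => pi.
    by apply: (np i); rewrite lt_neqAle eq_sym pi p0.
  by rewrite p1 => /eqP; rewrite oner_eq0.
have pall j : 0 < p j.
  by have [s /ppath/(_ pi)] := tr i j; rewrite last_rcons.
have -> : [set v : biseq R N | forall n : int, (`|n| <= M)%N -> v n = w n] =
    [set v | forall k : nat, (k <= M.*2)%N -> v (- M%:Z + k%:Z) = w (- M%:Z + k%:Z)].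
  apply/seteqP; split => v /= H n nM; first by apply: H; lia.
  have -> : n = - M%:Z + (absz (n + M%:Z)%R)%:Z by lia.
  by apply: H; lia.
rewrite (cyl (- M%:Z) M.*2 (fun k => w (- M%:Z + k%:Z))) lte_fin.
rewrite mulr_gt0 // prodr_gt0 // => k _; rewrite -AP.
have -> : - M%:Z + k.+1%:Z = - M%:Z + k%:Z + 1 by lia.
exact: Sw.
Qed.

End base_measure.

Section phase_measure.
Context {R : realType} {N : nat} (A : rel 'I_N.+1) (a b : R).
Context (mu : probability (biseq R N) R).
Local Notation Sig := (Sigma A : set (biseq R N)).
Local Notation D := (`[a, b]%classic : set R).
Local Notation X := (phase A a b).
Local Notation MX := (biseq R N * measurableTypeR R)%type.

(** The integral of the measures of the sections is zero, so almost every
    section is null. *)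
Lemma negligible_section (Z : set MX) : (mu_phase mu).-negligible Z ->
  {ae mu, forall w, lebesgue_measure.-negligible [set x : measurableTypeR R | Z (w, x)]}.
Proof.
move=> [Z' [mZ' Z'0 ZZ']].
have m0 : (\int[mu]_w `|(lebesgue_measure \o xsection Z') w| = 0)%E.
  by rewrite -[RHS]Z'0; apply: eq_integral => w _; rewrite gee0_abs.
have mZs : measurable_fun setT ((@lebesgue_measure R) \o xsection Z').
  exact: measurable_fun_xsection.
have /(ae_eq_integral_abs mu measurableT mZs) := m0.
apply: filterS => w /(_ I) /= w0.
exists (xsection Z' w); split => //; first exact: measurable_xsection.
by move=> x Zx; rewrite /xsection /= inE; exact: ZZ'.
Qed.

Lemma negligible_base (Z : set (biseq R N)) : mu.-negligible Z ->
  (mu_phase mu).-negligible [set p : MX | Z p.1].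
Proof.
move=> [Z' [mZ' Z'0 ZZ']]; exists (Z' `*` setT); split.
- exact: measurableX.
- have := product_measure1E mu (@lebesgue_measure R) mZ'
    (@measurableT _ (measurableTypeR R)).
  by rewrite [X in (X * _)%E](_ : _ = 0%E) ?mul0e.
- by move=> p Zp; split => //; exact: ZZ'.
Qed.

Lemma negligible_graph (phi : biseq R N -> R) : measurable_fun setT phi ->
  (mu_phase mu).-negligible [set p : MX | p.2 = phi p.1].
Proof.
move=> mphi; apply/negligibleP.
  have -> : [set p : MX | p.2 = phi p.1] =
      setT `&` (fun p : MX => p.2 - phi p.1) @^-1` [set 0].
    rewrite setTI; apply/seteqP; split => p /=; first by move=> ->; rewrite subrr.
    by move/eqP; rewrite subr_eq0 => /eqP.
  have mf : measurable_fun setT (fun p : MX => (p.2 : R) - phi p.1).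
    apply: measurable_funB; first exact: measurable_snd.
    exact: measurableT_comp mphi measurable_fst.
  by apply: mf => //; exact: measurable_set1.
rewrite /mu_phase /= /product_measure1 integral0_eq // => w _ /=.
have -> : xsection [set p : MX | p.2 = phi p.1] w = [set phi w].
  by apply/seteqP; split => x; rewrite /xsection /= inE.
exact: lebesgue_measure_set1.
Qed.

Lemma measurable_fun_coord (h : 'I_N.+1 -> MX -> R) :
  (forall j, measurable_fun X (h j)) ->
  measurable_fun (X : set MX) (fun p => h (p.1 0) p).
Proof.
move=> mh mX B mB.
have -> : (X : set MX) `&` (fun p => h (p.1 0) p) @^-1` B =
    \bigcup_(j in [set: 'I_N.+1])
      (([set w : biseq R N | w 0 = j] `*` setT) `&` (X `&` h j @^-1` B)).
  apply/seteqP; split => [p [Xp hp]|p [j _ [[/= pj _] [Xp hp]]]].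
    by exists (p.1 0).
  by split => //=; rewrite pj.
apply: fin_bigcup_measurable => // j _; apply: measurableI.
  by apply: measurableX => //; apply: biseq_open_measurable; exact: coord_open.
exact: mh.
Qed.

Lemma measurable_fun_base (h : biseq R N -> R) : measurable_fun Sig h ->
  measurable_fun (X : set MX) (fun p => h p.1).
Proof.
move=> mh mX B mB.
have -> : (X : set MX) `&` (fun p => h p.1) @^-1` B = (Sig `&` h @^-1` B) `*` D.
  by apply/seteqP; split => p /=; rewrite /phase /setX /=; tauto.
apply: measurableX; last exact: measurable_itv.
by apply: mh => //; exact: Sigma_measurable.
Qed.

Lemma measurable_fun_fiber (h : R -> R) : measurable_fun D h ->
  measurable_fun (X : set MX) (fun p => h p.2).
Proof.
move=> mh mX B mB.
have -> : (X : set MX) `&` (fun p => h p.2) @^-1` B = Sig `*` (D `&` h @^-1` B).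
  by apply/seteqP; split => p /=; rewrite /phase /setX /=; tauto.
apply: measurableX; first exact: Sigma_measurable.
by apply: mh => //; exact: measurable_itv.
Qed.

Lemma phase_measurable : measurable (X : set MX).
Proof. by apply: measurableX; [exact: Sigma_measurable|exact: measurable_itv]. Qed.

Section lift.
Variables (phi : biseq R N -> R) (nu : probability MX R).
Hypotheses (mphi : measurable_fun setT phi) (phiD : forall w, Sig w -> D (phi w)).
Hypothesis nuphi : lifts mu phi nu.

Let graph_map (w : biseq R N) : MX := (w, phi w).

Let graph_map_measurable : measurable_fun setT graph_map.
Proof.
by apply: measurable_fun_pair.
Qed.

(** Change of variables along the graph map, separately for the positive and the
    negative part. *)
Lemma Rintegral_lift (h : biseq R N * R -> R) : measurable_fun (X : set MX) h ->
  \int[nu]_(q in X) h q = \int[mu]_(w in Sig) h (w, phi w).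
Proof.
move=> mh; rewrite /Rintegral; congr fine.
rewrite integral_mkcond [RHS]integral_mkcond.
pose H : MX -> \bar R := (fun q => (h q)%:E) \_ (X : set MX).
have mH : measurable_fun setT H.
  by apply/(measurable_restrictT _ phase_measurable); apply/measurable_EFinP.
have -> : (fun w => (h (w, phi w))%:E) \_ Sig = H \o graph_map.
  apply/funext => w; rewrite /H /patch /= /graph_map.
  case: ifPn => [/set_mem Sw|/negP nSw].
    by rewrite ifT //; apply/mem_set; split => //; exact: phiD.
  by rewrite ifF //; apply/negP => /set_mem[/= Sw _]; exact/nSw/mem_set.
have -> : (\int[nu]_q H q = \int[pushforward mu graph_map]_q H q)%E.
  by apply: eq_measure_integral => B mB _; exact: nuphi.
rewrite [LHS]integralE [RHS]integralE.
rewrite funepos_comp funeneg_comp !ge0_integral_pushforward ?preimage_setT //.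
  exact: measurable_funeneg.
exact: measurable_funepos.
Qed.

End lift.
End phase_measure.

(** * Contraction along the fibers *)

Section multiplicative_decay.
Context {R : realType}.

(** The product of the factors up to [n] is the exponential of a sum
    asymptotic to [n * l]. *)
Lemma average_decay (d G : nat -> R) (n0 : nat) (l : R) : l < 0 ->
  (forall n, 0 <= d n) ->
  (forall n, (n0 <= n)%N -> d n.+1 <= expR (G n) * d n) ->
  n%:R^-1 * (\sum_(0 <= j < n) G j) @[n --> \oo] --> l ->
  d n @[n --> \oo] --> 0.
Proof.
move=> l0 d0 dG Gl.
pose S n := \sum_(0 <= j < n) G j.
have dS n : (n0 <= n)%N -> d n <= d n0 * expR (S n - S n0).
  elim: n => [|n IH].
    by rewrite leqn0 => /eqP ->; rewrite subrr expR0 mulr1.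
  rewrite leq_eqVlt => /predU1P[->|]; first by rewrite subrr expR0 mulr1.
  rewrite ltnS => n0n; apply: (le_trans (dG _ n0n)).
  rewrite /S big_nat_recr //= -/(S n) addrAC expRD mulrA [leLHS]mulrC.
  by rewrite ler_wpM2r ?expR_ge0 // IH.
have l2 : 0 < - (l / 2) by rewrite oppr_gt0 pmulr_llt0 // invr_gt0.
have Sl : \forall n \near \oo, S n <= n%:R * (l / 2).
  have /cvgrPdist_lt/(_ _ l2) := Gl.
  apply: filterS2 (nbhs_infty_gt 0) => n n0n; rewrite ltr_norml => /andP[h _].
  have n0' : 0 < n%:R :> R by rewrite ltr0n.
  have : n%:R^-1 * S n <= l / 2 by rewrite /S; lra.
  by rewrite ler_pdivrMl.
pose C := d n0 * expR (- S n0).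
have Ccvg : C * (expR (l / 2)) ^+ n @[n --> \oo] --> 0.
  rewrite -(mulr0 C); apply: cvgMr; apply: cvg_expr.
  by rewrite ger0_norm ?expR_ge0 // expR_lt1 -oppr_gt0.
apply: squeeze_cvgr Ccvg; last exact: cvg_cst.
apply: filterS2 (nbhs_infty_ge n0) Sl => n n0n Sn; rewrite d0 /=.
apply: (le_trans (dS _ n0n)); rewrite /C -mulrA ler_wpM2l //.
by rewrite -expRM_natl -expRD ler_expR; lra.
Qed.

End multiplicative_decay.

Section strip_contraction.
Context {R : realType} {N : nat} (A : rel 'I_N.+1) (a b : R) (ab : a < b).
Context (mu : probability (biseq R N) R).
Context (r : nat) (r1 : (1 <= r)%N).
Context (f : 'I_N.+1 -> R -> R) (ff : step_skew_product a b r f).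
Local Notation D := (`[a, b]%classic : set R).
Local Notation F := (skew_map f).
Local Notation X := (phase A a b).
Local Notation Sig := (Sigma A : set (biseq R N)).
Local Notation MX := (biseq R N * measurableTypeR R)%type.
Context (psi1 psi2 : biseq R N -> R) (P : set (biseq R N * R)).
Hypotheses (c1 : {within Sig, continuous psi1})
  (c2 : {within Sig, continuous psi2}).
Hypothesis psi12 : forall w, Sig w -> [/\ D (psi1 w), D (psi2 w) & psi1 w < psi2 w].
Hypothesis PE : P = [set p | Sig p.1 /\ psi1 p.1 <= p.2 <= psi2 p.1].
Hypothesis trapP : strictly_trapping f P.
Local Notation K := (maximal_attractor f P).
Context (phi : biseq R N -> R) (nu : probability MX R).
Hypotheses (gphi : graph_function A mu a b K phi) (lnu : lifts mu phi nu).
Local Notation width n w := (push f n psi2 w - push f n psi1 w).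

(** The lengths are bounded by that of the whole segment and tend to 0 almost
    everywhere. *)
Lemma width_integral_cvg0 :
  \int[mu]_(w in Sig) width n w @[n --> \oo] --> 0.
Proof.
have mS : measurable Sig := @Sigma_measurable R N A.
have mw n : measurable_fun Sig (fun w => width n w).
  apply: within_continuous_measurable => //.
  exact: (width_continuous ff c1 c2 psi12).
have wb n w : Sig w -> 0 <= width n w <= b - a by exact: (width_bound ff psi12).
have ib : mu.-integrable Sig (cst (b - a)%:E).
  by apply: finite_measure_integrable_cst.
have [|||||_ _] := @dominated_convergence _ _ R mu Sig mS
  (fun n w => (width n w)%:E) (cst 0%E) (cst (b - a)%:E).
- by move=> n; apply/measurable_EFinP.
- exact: measurable_cst.
- have [_ _] := gphi; apply: filterS => w /[swap] Sw /(_ Sw) Kw.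
  apply: cvg_EFin; first exact: nearW.
  exact: (width_cvg0 ff psi12 PE trapP Sw Kw).
- exact: ib.
- apply: aeW => w n Sw; have /andP[w0 wba] := wb n w Sw.
  by rewrite gee0_abs ?lee_fin.
rewrite integral0 => H; apply: (fine_cvg H).
Qed.

Lemma fiber_log_slope_continuous :
  {within X, continuous (fun p => ln (derive_in D (f (p.1 0)) p.2))}.
Proof.
apply: (@within_continuous_locally_cst _ _ _ X
   (fun p : biseq R N * R => p.1 0) (fun j p => ln (derive_in D (f j) p.2))).
  by move=> p; exact: (near_fst (near_coord p.1 0)).
move=> j; apply: (@within_continuous_comp_in _ _ _ X D snd
  (fun x => ln (derive_in D (f j) x))).
- by move=> p [].
- by apply: continuous_subspaceT => p; exact: cvg_snd.
- exact: ln_fiber_derive_continuous (ff j).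
Qed.

(** The derivative along the orbit of [p] has a negative average logarithm,
    and replacing a derivative by a difference quotient changes the average
    little because [p] and [q] both lie in the images of the strip, whose
    fibers have small length on average. *)
Lemma empirical_contraction p q : lyapunov A mu a b f phi < 0 ->
  P p -> P q -> p.1 = q.1 -> empirical_cvg A a b F p nu ->
  (iter n F p).2 - (iter n F q).2 @[n --> \oo] --> 0.
Proof.
move=> l0 Pp Pq pq emp.
set l := lyapunov _ _ _ _ _ _ in l0.
(* The two error terms, [e] and [C] times the mean length, stay below [- l / 4]
   each, which leaves an average below [l / 2]. *)
pose e := - l / 4.
have e0 : 0 < e by rewrite divr_gt0 // oppr_gt0.
have /choice[Cj HC] : forall j, exists C, 0 <= C /\ forall x y, D x -> D y ->
  `|f j x - f j y| <=
    expR (ln (derive_in D (f j) x) + e + C * `|x - y|) * `|x - y|.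
  by move=> j; have [C C0 HC] := fiber_dist_le ab r1 (ff j) e0; exists C.
pose C := \sum_j Cj j.
have CjC j : Cj j <= C.
  by rewrite /C (bigD1 j) //= lerDl; apply: sumr_ge0 => i _; case: (HC i).
have [M MC] : exists M, C * (\int[mu]_(w in Sig) width M w) < e.
  have : C * \int[mu]_(w in Sig) width n w @[n --> \oo] --> 0.
    by rewrite -(mulr0 C); apply: cvgMr; exact: width_integral_cvg0.
  move=> /cvgrPdist_lt/(_ _ e0)/filter_ex[M]; rewrite sub0r normrN => /ltr_normlW MC.
  by exists M.
have [mphi phiD _] := gphi.
have wc : {within Sig, continuous (fun w => width M w)}.
  exact: (width_continuous ff c1 c2 psi12).
have avg1 := emp _ fiber_log_slope_continuous.
have avg2 : n%:R^-1 * (\sum_(0 <= j < n) width M (iter j F p).1) @[n --> \oo]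
    --> \int[nu]_(q in X) width M q.1.
  apply: (emp (fun q => width M q.1)).
  apply: (@within_continuous_comp_in _ _ _ X Sig fst) wc => [q' []//|].
  by apply: continuous_subspaceT => p'; exact: cvg_fst.
have mS : measurable Sig := @Sigma_measurable R N A.
rewrite (Rintegral_lift mphi phiD lnu) in avg1; last first.
  apply: (@measurable_fun_coord _ _ _ _ _ (fun j (p : MX) =>
    ln (derive_in D (f j) p.2))) => j.
  apply: (@measurable_fun_fiber _ _ _ _ _ (fun x => ln (derive_in D (f j) x))).
  apply: subspace_continuous_measurable_fun; first exact: measurable_itv.
  exact: ln_fiber_derive_continuous (ff j).
rewrite (Rintegral_lift mphi phiD lnu) in avg2; last first.
  apply: (@measurable_fun_base _ _ _ _ _ (fun w => width M w)).
  exact: within_continuous_measurable.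
rewrite /= in avg1 avg2.
pose G n := ln (derive_in D (f ((iter n F p).1 0)) (iter n F p).2) + e +
  C * width M (iter n F p).1.
have avgG : n%:R^-1 * (\sum_(0 <= j < n) G j) @[n --> \oo] -->
    (l + e + C * \int[mu]_(w in Sig) width M w).
  have avge : n%:R^-1 * (\sum_(0 <= j < n) e) @[n --> \oo] --> e.
    apply: cvg_near_cst; apply: filterS (nbhs_infty_gt 0) => n n0.
    rewrite big_const_nat iter_addr_0 subn0 -[e *+ n]mulr_natl mulrA mulVf ?mul1r //.
    by rewrite pnatr_eq0 -lt0n.
  have avgD (u v w : nat -> R) n :
      n%:R^-1 * (\sum_(0 <= j < n) (u j + v j + C * w j)) =
      n%:R^-1 * (\sum_(0 <= j < n) u j) + n%:R^-1 * (\sum_(0 <= j < n) v j) +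
      C * (n%:R^-1 * (\sum_(0 <= j < n) w j)).
    by rewrite !big_split /= !mulrDr -mulr_sumr [C * _]mulrCA.
  rewrite (funext (avgD _ (fun=> e) (fun j => width M (iter j F p).1))).
  by apply: cvgD; [exact: cvgD avg1 avge|exact: cvgM (cvg_cst C) avg2].
have XF s : P s -> forall n, X (iter n F s).
  by move=> Ps n; apply: (iter_skew_phase ff); exact: strip_phase psi12 PE _ Ps.
apply/norm_cvg0P.
apply: (@average_decay _ _ G M _ _ _ _ avgG) => // [|n Mn].
  have : e = - l / 4 by []. by move=> ?; lra.
have [_ Dp] := XF _ Pp n; have [_ Dq] := XF _ Pq n.
have pqn : (iter n F p).1 = (iter n F q).1 by rewrite !iter_skew_fst pq.
rewrite /= -pqn.
have [_ H] := HC ((iter n F p).1 0).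
apply: (le_trans (H _ _ Dp Dq)); rewrite ler_wpM2r // ler_expR /G lerD2l.
have := orbit_between ff psi12 PE trapP Mn Pp.
have := orbit_between ff psi12 PE trapP Mn Pq; rewrite -pqn.
move=> /andP[? ?] /andP[? ?].
have [Cj0 _] := HC ((iter n F p).1 0).
apply: ler_pM => //; rewrite ler_norml; apply/andP; split; lra.
Qed.

(** Each fiber of a strip has positive length, so it is not contained in a null
    set. *)
Lemma ae_strip_fiber (Q : biseq R N * R -> Prop) :
  {ae mu_phase mu, forall p, P p -> Q p} ->
  {ae mu, forall w, Sig w -> exists2 x, P (w, x) & Q (w, x)}.
Proof.
move=> /negligible_section; apply: filterS => w [Z [mZ Z0 ZQ]] Sw.
apply: contrapT => nQ.
have sub : [set` `[psi1 w, psi2 w]] `<=` Z.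
  move=> x; rewrite /= in_itv /= => px; apply: ZQ => /= H; apply: nQ.
  have Pwx : P (w, x) by rewrite PE.
  by exists x => //; exact: H.
have : (lebesgue_measure [set` `[psi1 w, psi2 w]] <= lebesgue_measure Z)%E.
  by apply: le_measure => //; rewrite inE.
have [_ _ lt12] := psi12 Sw.
by rewrite Z0 lebesgue_measure_itv /= lte_fin lt12 -EFinB lee_fin subr_le0 leNgt lt12.
Qed.

Hypothesis neg : lyapunov A mu a b f phi < 0.
Hypothesis emp : {ae mu_phase mu, forall p, P p -> empirical_cvg A a b F p nu}.

(** Two points of the fiber are compared through a third one, whose time
    averages converge. *)
Lemma ae_fiber_contraction : {ae mu, forall w, Sig w ->
  forall x y, P (w, x) -> P (w, y) ->
  (iter n F (w, x)).2 - (iter n F (w, y)).2 @[n --> \oo] --> 0}.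
Proof.
have := ae_strip_fiber emp; apply: filterS => w /[apply] -[z Pz ez] x y Px Py.
have zx := empirical_contraction neg Pz Px erefl ez.
have zy := empirical_contraction neg Pz Py erefl ez.
have xyE n : (iter n F (w, x)).2 - (iter n F (w, y)).2 =
    ((iter n F (w, z)).2 - (iter n F (w, y)).2) -
    ((iter n F (w, z)).2 - (iter n F (w, x)).2) by lra.
by rewrite (funext xyE) -[0](subrr 0); exact: cvgB.
Qed.

End strip_contraction.

(** * Limit sets of orbits in a trapping strip *)

Lemma average_eventually0 {R : realType} (u : nat -> R) :
  (\forall n \near \oo, u n = 0) ->
  n%:R^-1 * (\sum_(0 <= j < n) u j) @[n --> \oo] --> 0.
Proof.
move=> u0; rewrite -(cvg_shiftS (fun n : nat => n%:R^-1 * (\sum_(0 <= j < n) u j))).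
have /cesaro : u n @[n --> \oo] --> 0 by exact: cvg_near_cst.
by rewrite /arithmetic_mean /series.
Qed.

Section omega_limits.
Context {R : realType} {N : nat} (f : 'I_N.+1 -> R -> R).
Local Notation F := (skew_map f).
Implicit Types (p q : biseq R N * R).

Lemma omega_limit_iter k p : omega_limit f p `<=` omega_limit f (iter k F p).
Proof.
move=> q clq B V [n0 _ Bn] qV; apply: clq qV.
exists (n0 + k)%N => // n /= n0k.
have -> : n = ((n - k) + k)%N by lia.
by rewrite iterD; apply: Bn => /=; lia.
Qed.

Lemma omega_limitP p q : omega_limit f p q <->
  forall B, nbhs q B -> forall n0, exists2 n, (n0 <= n)%N & B (iter n F p).
Proof.
split=> [clq B qB n0|H B V [n0 _ Bn] qV].
  have nn0 : nbhs ((fun n => iter n F p) @ \oo)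
      ([set iter n F p | n in [set n | (n0 <= n)%N]]).
    by exists n0 => // n n0n; exists n.
  by have [_ [[n n0n <-] Bn]] := clq _ _ nn0 qB; exists n.
have [n n0n Vn] := H V qV n0.
by exists (iter n F p); split => //; exact: Bn.
Qed.

Lemma omega_limit_asymptotic (S : set (biseq R N * R)) p q : p.1 = q.1 ->
  (iter n F p).2 - (iter n F q).2 @[n --> \oo] --> 0 ->
  (forall n, S (iter n F q)) -> omega_limit f p `<=` closure S.
Proof.
move=> pq pq0 Sq s /omega_limitP sp B /nbhs_ballP[e /= e0 sB].
have e20 : 0 < e / 2 by rewrite divr_gt0.
have /cvgrPdist_lt/(_ _ e20)[n0 _ Hn] := pq0.
have [n n0n [/= b1 b2]] := sp _ (nbhsx_ballx s (e / 2) e20) n0.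
exists (iter n F q); split => //; apply: sB; split.
  rewrite /= (_ : (iter n F q).1 = (iter n F p).1); last by rewrite !iter_skew_fst pq.
  apply: le_ball b1.
  by rewrite ler_pdivrMr // ler_peMr ?ler1n // ltW.
have := Hn n n0n; rewrite sub0r normrN /= => h.
have := @ball_triangle _ _ (iter n F p).2 s.2 (iter n F q).2 (e / 2) (e / 2) b2.
by rewrite -splitr; apply.
Qed.

End omega_limits.

Section strip_limits.
Context {R : realType} {N : nat} (A : rel 'I_N.+1) (a b : R) (ab : a < b).
Context (mu : probability (biseq R N) R) (mk : markov_measure A mu).
Context (tr : transitive_chain A).
Context (inv : invariant_measure (Sigma A) bishift mu).
Context (r : nat) (r1 : (1 <= r)%N).
Context (f : 'I_N.+1 -> R -> R) (ff : step_skew_product a b r f).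
Local Notation D := (`[a, b]%classic : set R).
Local Notation F := (skew_map f).
Local Notation X := (phase A a b).
Local Notation Sig := (Sigma A : set (biseq R N)).
Local Notation MX := (biseq R N * measurableTypeR R)%type.
Context (P : set (biseq R N * R)) (sP : strip A a b P).
Hypothesis trapP : strictly_trapping f P.
Local Notation K := (maximal_attractor f P).
Context (phi : biseq R N -> R) (nu : probability MX R).
Hypotheses (gphi : graph_function A mu a b K phi) (lnu : lifts mu phi nu).
Hypothesis neg : lyapunov A mu a b f phi < 0.
Hypothesis emp : {ae mu_phase mu, forall p, P p -> empirical_cvg A a b F p nu}.

(** Along almost every fiber all points of the strip are asymptotic to the
    point of the attractor, whose orbit stays in the graph. *)
Lemma ae_omega_limit_strip : {ae mu, forall w, Sig w -> forall x, P (w, x) ->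
  omega_limit f (w, x) `<=` closure (graph_part A K)}.
Proof.
have [psi1 [psi2 [c1 c2 psi12 PE]]] := sP.
have con := ae_fiber_contraction ab r1 ff c1 c2 psi12 PE trapP gphi lnu neg emp.
have [_ _ sing] := gphi.
have sings := ae_orbit inv sing.
apply: filterS2 con sings => w con sings Sw x Pwx.
have Kw := sings Sw 0%N; rewrite /= in Kw.
have Kz : K (w, phi w) by change (fiber_of K w (phi w)); rewrite Kw.
have Pz : P (w, phi w) := attractor_sub trapP Kz.
apply: (@omega_limit_asymptotic _ _ f _ (w, x) (w, phi w)) => //; first exact: con.
move=> n; have Kn : K (iter n F (w, phi w)).
  by elim: n => //= n; exact: (attractor_skew trapP).
have Xn : X (iter n F (w, phi w)).
  by apply: (iter_skew_phase ff); apply: (strip_phase psi12 PE).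
split; first exact: Xn.1.
have Ksing := sings Sw n.
have e1 : (iter n F (w, phi w)).1 = iter n bishift w by rewrite iter_skew_fst.
rewrite e1 Ksing.
have : fiber_of K (iter n bishift w) (iter n F (w, phi w)).2.
  by rewrite /fiber_of /= -e1 -surjective_pairing.
by rewrite Ksing /= => ->.
Qed.

(** Otherwise the time averages of the indicator of the cylinder would tend to
    0 and not to its measure. The indicator is continuous because cylinders are
    open and closed. *)
Lemma cylinder_visits p (eta : biseq R N) M n0 : Sig eta ->
  empirical_cvg A a b F p nu ->
  exists2 n, (n0 <= n)%N & forall k : int, (`|k| <= M)%N -> (iter n F p).1 k = eta k.
Proof.
move=> Seta emp_p.
pose C := [set v : biseq R N | forall k : int, (`|k| <= M)%N -> v k = eta k].
have oC : open C.
  rewrite openE => v Cv; apply: filterS (near_agree v M) => v' H k kM.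
  by rewrite H // Cv.
have mC : measurable C by exact: biseq_open_measurable.
have Cc : {within X, continuous (fun p => \1_C p.1 : R)}.
  apply: continuous_subspaceT => s; apply: cvg_near_cst.
  have agree : \forall t \near s, forall k : int, (`|k| <= M)%N -> t.1 k = s.1 k.
    exact: (near_fst (near_agree s.1 M)).
  apply: filterS agree => t H.
  rewrite !indicE; congr ((nat_of_bool _)%:R).
  apply/idP/idP => /set_mem Cs; apply/mem_set => k kM.
    by rewrite -H // Cs.
  by rewrite H // Cs.
have avg := emp_p _ Cc.
have [mphi phiD _] := gphi.
rewrite (Rintegral_lift mphi phiD lnu) in avg; last first.
  apply: (@measurable_fun_base _ _ _ _ _ (fun w => \1_C w : R)).
  exact: measurable_indic.
have pos : 0 < \int[mu]_(w in Sig) (\1_C w : R).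
  have mS : measurable Sig := @Sigma_measurable R N A.
  rewrite /Rintegral integral_indic //.
  have mCS : measurable (C `&` Sig) by exact: measurableI.
  apply: fine_gt0; rewrite (le_lt_trans (probability_le1 mu mCS) (ltry 1)) andbT.
  rewrite lt0e measure_ge0 andbT; apply/negP => /eqP CS0.
  have : mu C = 0%E.
    apply/negligibleP => //; apply: (@negligibleS _ _ _ _ ((C `&` Sig) `|` ~` Sig)).
      by move=> v Cv; case: (pselect (Sig v)); [left|right].
    apply: negligibleU; last exact: (markov_Sigma mk).
    by apply/negligibleP => //; exact: measurableI.
  by move=> C0; have := markov_cylinder_gt0 mk M tr Seta; rewrite -/C C0 ltxx.
apply: contrapT => nH.
have u0 : \forall n \near \oo, (\1_C (iter n F p).1 : R) = 0.
  exists n0 => // n n0n; rewrite indicE memNset // => Cn.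
  by apply: nH; exists n.
have := average_eventually0 u0.
move=> /(cvg_unique (@Rhausdorff R) avg) /= E.
by move: pos; rewrite /= E ltxx.
Qed.

(** Upper semicontinuity of the fibers of a closed set in a product with a
    compact factor. *)
Lemma attractor_upper_semicontinuous eta y (e : R) : closed K -> 0 < e ->
  fiber_of K eta = [set y] ->
  \forall v \near eta, forall x, K (v, x) -> `|x - y| < e.
Proof.
move=> cK e0 Ky.
have [psi1 [psi2 [c1 c2 psi12 PE]]] := sP.
have /compact_near_coveringP/near_covering_withinP cov := @segment_compact R a b.
have := cov _ (nbhs eta) (fun v x => K (v, x) -> `|x - y| < e) _.
have H : forall x, `[a, b]%classic x ->
    \forall x' \near x & v \near eta, `[a, b]%classic x' -> K (v, x') -> `|x' - y| < e.
  move=> x Dx; have [Kx|nKx] := pselect (K (eta, x)).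
    have xy : x = y by have : fiber_of K eta x by []; rewrite Ky.
    exists (ball y e, setT).
      by split; [rewrite xy; exact: nbhsx_ballx|exact: filterT].
    by move=> [x' v] /= [yx' _] _ _; rewrite distrC.
  have : nbhs (eta, x) (~` K) by apply: open_nbhs_nbhs; split => //; exact: closed_openC.
  move=> [[U V] /= [Ueta Vx] UV]; exists (V, U) => //.
  by move=> [x' v] /= [Vx' Uv] _ Kvx; have := UV (v, x'); case.
move=> /(_ _ H); apply: filterS => v Hv x Kvx.
by apply: Hv => //; have [] := strip_phase psi12 PE (attractor_sub trapP Kvx).
Qed.

(** At the times when the base orbit visits a small cylinder around the base
    point of [q], the orbit of [(w, z)] is close to [q] since it stays in the
    attractor, and the orbit of [(w, x)] follows it. *)
Lemma graph_part_omega_limit w x z q : closed K ->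
  P (w, x) -> K (w, z) -> empirical_cvg A a b F (w, x) nu ->
  (iter n F (w, x)).2 - (iter n F (w, z)).2 @[n --> \oo] --> 0 ->
  graph_part A K q -> omega_limit f (w, x) q.
Proof.
move=> cK Px Kz emp_x xz [Sq Kq]; apply/omega_limitP => B /nbhs_ballP[e /= e0 qB] n0.
have e20 : 0 < e / 2 by rewrite divr_gt0.
have usc := attractor_upper_semicontinuous cK e20 Kq.
have [M HM] := nbhs_agree (filterI usc (nbhsx_ballx q.1 e e0)).
have /cvgrPdist_lt/(_ _ e20)[n1 _ Hn] := xz.
have [n n01 vis] := cylinder_visits M (maxn n0 n1) Sq emp_x.
exists n; first by rewrite (leq_trans _ n01) // leq_maxl.
have [near_q qe] := HM _ vis.
apply: qB; split => //=.
have Kn : K (iter n F (w, z)).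
  by elim: n {n01 vis near_q qe} => //= n; exact: (attractor_skew trapP).
have e1 : (iter n F (w, x)).1 = (iter n F (w, z)).1 by rewrite !iter_skew_fst.
have zy : `|(iter n F (w, z)).2 - q.2| < e / 2.
  by apply: near_q; rewrite e1 -surjective_pairing.
have := Hn n (leq_trans (leq_maxr _ _) n01); rewrite sub0r normrN /= => xzn.
rewrite /ball /= distrC.
have := ler_distD (iter n F (w, z)).2 (iter n F (w, x)).2 q.2.
lra.
Qed.

End strip_limits.

Section null_graphs.
Context {R : realType} {N : nat} (A : rel 'I_N.+1) (a b : R).
Context (mu : probability (biseq R N) R) (f : 'I_N.+1 -> R -> R).
Local Notation X := (phase A a b).

Lemma graph_function_negligible K phi : K `<=` X ->
  graph_function A mu a b K phi -> (mu_phase mu).-negligible K.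
Proof.
move=> KX [mphi _ /negligible_base nb].
apply: negligibleS (negligibleU nb (negligible_graph mu mphi)).
move=> [w x] Kwx; case: (pselect (x = phi w)) => wx; [by right|left] => /= H.
apply: wx; have : fiber_of K w x by [].
by rewrite H //; exact: (KX _ Kwx).1.
Qed.

End null_graphs.

(** * The Milnor attractor *)

Theorem theorem3p4 (R : realType) (N : nat) (A : rel 'I_N.+1)
    (mu : probability (biseq R N) R) (a b : R) (r : nat)
    (calI : set ('I_N.+1 -> R -> R)) :
  transitive_chain A ->
  markov_measure A mu ->
  invariant_measure (Sigma A) bishift mu ->
  ergodic_measure (Sigma A) bishift mu ->
  a < b ->
  (1 <= r)%N ->
  calI `<=` step_skew_product a b r ->
  Cr_open a b r calI ->
  Cr_dense a b r calI ->
  (forall f, calI f ->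
     exists (l m : nat) (Pi : 'I_l -> set (biseq R N * R))
       (Pi' : 'I_m -> set (biseq R N * R)), kleptsyn_volk A mu a b f Pi Pi') ->
  forall f, calI f ->
  forall (l m : nat) (Pi : 'I_l -> set (biseq R N * R))
    (Pi' : 'I_m -> set (biseq R N * R)),
    kleptsyn_volk A mu a b f Pi Pi' ->
    milnor_attractor A mu a b f =
    closure (\bigcup_(i in [set: 'I_l]) graph_part A (maximal_attractor f (Pi i))).
Proof.
move=> tr mk inv _ ab r1 calIs _ _ _ f /calIs ff l m Pi Pi'.
move=> [[tP tP'] cover [bonyA bonyR] statA statR].
set S := \bigcup_(i in _) _; set X := phase A a b.
pose F := skew_map f.
have stripX P : strip A a b P -> P `<=` X.
  by move=> [psi1 [psi2 [_ _ psi12 PE]]]; exact: strip_phase psi12 PE.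
apply/seteqP; split.
  move=> q; apply; split; first exact: closed_closure.
    have /closure_id XE : closed X by exact: phase_closed.
    rewrite -/X XE; apply: closure_subset => p [i _ [_ Kp]].
    have [_ KX _ _] := bonyA i; apply: KX.
    rewrite (surjective_pairing p).
    by change (fiber_of (maximal_attractor f (Pi i)) p.1 p.2); rewrite Kp.
  have good : {ae mu, forall w, Sigma A w -> forall i x, Pi i (w, x) ->
      omega_limit f (w, x) `<=` closure S}.
    have : {ae mu, forall w, forall i, Sigma A w -> forall x, Pi i (w, x) ->
        omega_limit f (w, x) `<=` closure S}.
      apply: filter_forall => i.
      have [sPi tPi] := tP i.
      have [phi [nu [[gphi lnu] _ _ emp neg]]] := statA i.
      have := ae_omega_limit_strip ab inv r1 ff sPi tPi gphi lnu neg emp.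
      apply: filterS => w Hw Sw x Pwx; apply: subset_trans (Hw Sw x Pwx) _.
      by apply: closure_subset => p Gp; exists i.
    by apply: filterS => w Hw Sw i; exact: Hw.
  have escape : {ae mu_phase mu, forall p j,
      ~ maximal_repeller A a b f (Pi' j) p}.
    apply: filter_forall => j.
    have [phi [nu [[gphi _] _ _ _ _]]] := statR j.
    apply: (negligibleS _ (graph_function_negligible _ gphi)).
      by move=> p /contrapT.
    by move=> p /(_ 1%N isT)[].
  have good' : {ae mu_phase mu, forall p, Sigma A p.1 -> forall n i x,
      Pi i (iter n bishift p.1, x) ->
      omega_limit f (iter n bishift p.1, x) `<=` closure S}.
    exact: negligible_base (ae_orbit inv good).
  apply: filterS2 good' escape => p goodp escp Xp.
  (* A point outside the repeller is outside [Pi' j] at some time, hence at all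
     later times. *)
  have leave j : exists n, forall k, ~ Pi' j (iter (k + n) F p).
    have [sP' tP'j] := tP' j.
    have /existsNP[n /not_implyP[_ nP]] := escp j.
    exists n => k; rewrite iterD; apply: (inverse_trapping_avoid ff _ tP'j).
    - exact: stripX.
    - exact: (iter_skew_phase ff).
    - by move=> Pn; apply: nP.
  have [n Hn] := choice leave.
  pose M := \max_j n j.
  have XM : X (iter M F p) by exact: (iter_skew_phase ff).
  have [[i _ PiM]|[j _]] := cover _ XM; last first.
    move=> Pj; exfalso; apply: (Hn j (M - n j)%N).
    by rewrite subnK // /M; exact: leq_bigmax.
  apply: subset_trans (@omega_limit_iter _ _ f M p) _.
  have MF : iter M F p = (iter M bishift p.1, (iter M F p).2).
    by rewrite -(iter_skew_fst f) -surjective_pairing.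
  move: PiM; rewrite MF => PiM; apply: goodp PiM; exact: Xp.1.
move=> q Sq Kc [cK _ aeK].
suff : S `<=` Kc by move=> /closure_subset; rewrite -(closure_id Kc).1 //; apply.
move=> {Sq}q [i _ Gq].
have [sPi tPi] := tP i.
have [phi [nu [[gphi lnu] _ _ emp neg]]] := statA i.
have [cKi _ _ _] := bonyA i.
have [psi1 [psi2 [c1 c2 psi12 PE]]] := sPi.
have con := ae_fiber_contraction ab r1 ff c1 c2 psi12 PE tPi gphi lnu neg emp.
pose Q p := empirical_cvg A a b F p nu /\ omega_limit f p `<=` Kc.
have aeF : Filter (almost_everywhere (mu_phase mu)).
  exact: ae_filter_ringOfSetsType.
have aeQ : {ae mu_phase mu, forall p, Pi i p -> Q p}.
  apply: (@filterS2 _ _ aeF _ _ _ _ emp aeK) => p ep oK Pp.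
  by split; [exact: ep|apply: oK; exact: stripX Pp].
have start := ae_strip_fiber psi12 PE aeQ.
have [_ _ sing] := gphi.
have mu0 : (0 < mu setT)%E by rewrite probability_setT lte01.
have pf := ae_properfilter_algebraOfSetsType mu0.
have [w [[[Sw conw] startw] singw]] :=
  filter_ex (filterI (filterI (filterI (markov_Sigma mk) con) start) sing).
have [x Px [ex oK]] := startw Sw; apply: oK.
have Kw := singw Sw.
have Kz : maximal_attractor f (Pi i) (w, phi w).
  by change (fiber_of (maximal_attractor f (Pi i)) w (phi w)); rewrite Kw.
have Pz := attractor_sub tPi Kz.
exact: (graph_part_omega_limit mk tr sPi tPi gphi lnu cKi Px Kz ex
  (conw Sw _ _ Px Pz) Gq).
Qed.
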